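(* Let $\mathcal{C}$ be a centralizable autonomous category, with centralizer $(Z,\partial)$. Then the forgetful functor $\mathcal{U}\colon\mathcal{Z}(\mathcal{C})\to\mathcal{C}$, $(M,\sigma)\mapsto M$, is monadic with monad $Z$. In fact $Z$ is a Hopf monad and the functor $Z\text{-}\mathcal{C}\to\mathcal{Z}(\mathcal{C})$ defined by $$(M,r)\mapsto \bigl(M,\{(\mathrm{id}_Y\otimes r)\partial_{M,Y}\}_{Y}\bigr)\quad\text{and}\quad f\mapsto f$$ is a strict monoidal isomorphism of categories.
   Context: Categories are small and monoidal categories are strict, with product $\otimes$ and unit $\mathbf 1$. A monoidal category is autonomous if every object $X$ has a left dual ${}^\vee X$ (with $\mathrm{ev}_X\colon {}^\vee X\otimes X\to\mathbf 1$, $\mathrm{coev}_X\colon \mathbf 1\to X\otimes {}^\vee X$) and a right dual $X^\vee$ (with $\widetilde{\mathrm{ev}}_X\colon X\otimes X^\vee\to \mathbf 1$, $\widetilde{\mathrm{coev}}_X\colon \mathbf 1\to X^\vee\otimes X$). Duals are chosen. A comonoidal functor $F$ is a functor with a coassociative and counital natural transformation $F_2(X,Y)\colon F(X\otimes Y)\to F(X)\otimes F(Y)$, $F_0\colon F(\mathbf 1)\to\mathbf 1$; comonoidal natural transformations are those compatible with these. A bimonad is a monad $(T,\mu,\eta)$ with a comonoidal structure on $T$ such that $\mu,\eta$ are comonoidal. A left antipode for $T$ is a natural transformation $s^l_X\colon T({}^\vee T(X))\to {}^\vee X$ with $T_0T(\mathrm{ev}_X)T({}^\vee\eta_X\otimes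 \mathrm{id}_X)=\mathrm{ev}_{T(X)}(s^l_{T(X)}T({}^\vee\mu_X)\otimes \mathrm{id})T_2({}^\vee T(X),X)$ and $(\eta_X\otimes \mathrm{id}_{{}^\vee X})\mathrm{coev}_XT_0=(\mu_X\otimes s^l_X)T_2(T(X),{}^\vee T(X))T(\mathrm{coev}_{T(X)})$. A right antipode is a natural transformation $s^r_X\colon T(T(X)^\vee)\to X^\vee$ with $T_0T(\widetilde{\mathrm{ev}}_X)T(\mathrm{id}_X\otimes\eta_X^\vee)=\widetilde{\mathrm{ev}}_{T(X)}(\mathrm{id}\otimes s^r_{T(X)}T(\mu_X^\vee))T_2(X,T(X)^\vee)$ and $(\mathrm{id}_{X^\vee}\otimes\eta_X)\widetilde{\mathrm{coev}}_XT_0=(s^r_X\otimes\mu_X)T_2(T(X)^\vee,T(X))T(\widetilde{\mathrm{coev}}_{T(X)})$. A Hopf monad is a bimonad on an autonomous category having a left and a right antipode. For a monad $T$, a $T$-module is a pair $(M,r)$ with $r\colon T(M)\to M$, $rT(r)=r\mu_M$, $r\eta_M=\mathrm{id}_M$; $T\text{-}\mathcal{C}$ is the category of $T$-modules and $T$-linear morphisms. If $T$ is a bimonad, $T\text{-}\mathcal{C}$ is monoidal with $(M,r)\otimes(N,s)=(M\otimes N,(r\otimes s)T_2(M,N))$ and unit $(\mathbf 1,T_0)$. A functor $U\colon \mathcal{D}\to\mathcal{C}$ is monadic if it has a left adjoint $F$ and the comparison functor $\mathcal{D}\to (UF)\text{-}\mathcal{C}$ is an equivalence; the monad of $U$ is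 then $UF$ (well defined up to unique isomorphism). The center $\mathcal{Z}(\mathcal{C})$ has as objects pairs $(M,\sigma)$, $\sigma=\{\sigma_Y\colon M\otimes Y\to Y\otimes M\}_Y$ a natural isomorphism with $\sigma_{Y\otimes Z}=(\mathrm{id}_Y\otimes\sigma_Z)(\sigma_Y\otimes\mathrm{id}_Z)$ and $\sigma_{\mathbf 1}=\mathrm{id}_M$; morphisms $(M,\sigma)\to(M',\sigma')$ are $f\colon M\to M'$ with $(\mathrm{id}_Y\otimes f)\sigma_Y=\sigma'_Y(f\otimes\mathrm{id}_Y)$; and $(M,\sigma)\otimes(N,\gamma)=(M\otimes N,(\sigma\otimes\mathrm{id}_N)(\mathrm{id}_M\otimes\gamma))$. A monoidal category $\mathcal{C}$ is centralizable if its identity endofunctor has a centralizer, i.e. if there are an endofunctor $Z$ of $\mathcal{C}$ and $\partial_{X,Y}\colon X\otimes Y\to Y\otimes Z(X)$, natural in $X,Y$, such that for all objects $X,W$ and every natural $\{\xi_Y\colon X\otimes Y\to Y\otimes W\}_Y$ there is a unique $r\colon Z(X)\to W$ with $\xi_Y=(\mathrm{id}_Y\otimes r)\partial_{X,Y}$ for all $Y$. Then $(Z,\partial)$ is called the centralizer of $\mathcal{C}$. The bimonad structure on $Z$ is the one determined by $(\mathrm{id}_{Y_1\otimes Y_2}\otimes m_X)(\mathrm{id}_{Y_1}\otimes\partial_{Z(X),Y_2})(\partial_{X,Y_1}\otimes\mathrm{id}_{Y_2})=\partial_{X,Y_1\otimes Y_2}$, $u_X=\partial_{X,\mathbf 1}$,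 $(\mathrm{id}_Y\otimes Z_2(X_1,X_2))\partial_{X_1\otimes X_2,Y}=(\partial_{X_1,Y}\otimes\mathrm{id}_{Z(X_2)})(\mathrm{id}_{X_1}\otimes\partial_{X_2,Y})$, $(\mathrm{id}_Y\otimes Z_0)\partial_{\mathbf 1,Y}=\mathrm{id}_Y$, where $m$ and $u$ are the product and unit of $Z$. *)

(* Defs.v *)
From Stdlib Require Import ProofIrrelevance FunctionalExtensionality Setoid.

Set Implicit Arguments.
Unset Strict Implicit.
Unset Printing Implicit Defensive.
Set Asymmetric Patterns.

Declare Scope cat_scope.
Delimit Scope cat_scope with cat.
Local Open Scope cat_scope.

Record Category := MkCategory {
  Ob :> Type;
  Hom : Ob -> Ob -> Type;
  id : forall X, Hom X X;
  comp : forall X Y Z, Hom Y Z -> Hom X Y -> Hom X Z;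
  comp_idl : forall X Y (f : Hom X Y), comp (id Y) f = f;
  comp_idr : forall X Y (f : Hom X Y), comp f (id X) = f;
  compA : forall X Y Z W (h : Hom Z W) (g : Hom Y Z) (f : Hom X Y),
    comp h (comp g f) = comp (comp h g) f }.

Arguments Hom {c} X Y.
Arguments id {c} X.
Arguments comp {c X Y Z} g f.

Notation "X ~> Y" := (Hom X Y) (at level 60, no associativity) : cat_scope.
Notation "g ∘ f" := (comp g f) (at level 40, left associativity) : cat_scope.

Definition is_iso (C : Category) (X Y : C) (f : X ~> Y) : Prop :=
  exists g : Y ~> X, g ∘ f = id X /\ f ∘ g = id Y.

(* The identity morphism of X, seen as a morphism to an equal object Y.  These
   are the only "coherence" morphisms used below; since equality proofs are
   irrelevant, idhom e depends only on its source and target. *)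
Definition idhom (C : Category) (X Y : C) (e : X = Y) : X ~> Y :=
  match e in _ = Y' return X ~> Y' with eq_refl => id X end.

Record Functor (C D : Category) := MkFunctor {
  fobj :> C -> D;
  fmap : forall X Y : C, X ~> Y -> fobj X ~> fobj Y;
  fmap_id : forall X : C, fmap (id X) = id (fobj X);
  fmap_comp : forall (X Y Z : C) (g : Y ~> Z) (f : X ~> Y),
    fmap (g ∘ f) = fmap g ∘ fmap f }.

Arguments fmap {C D} F {X Y} f : rename.

Definition functor_id (C : Category) : Functor C C :=
  @MkFunctor C C (fun X => X) (fun _ _ f => f)
    (fun _ => eq_refl) (fun _ _ _ _ _ => eq_refl).

Lemma functor_comp_id (C D E : Category) (G : Functor D E) (F : Functor C D)
    (X : C) : fmap G (fmap F (id X)) = id (G (F X)).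
Proof. now rewrite !fmap_id. Qed.

Lemma functor_comp_comp (C D E : Category) (G : Functor D E) (F : Functor C D)
    (X Y Z : C) (g : Y ~> Z) (f : X ~> Y) :
  fmap G (fmap F (g ∘ f)) = fmap G (fmap F g) ∘ fmap G (fmap F f).
Proof. now rewrite !fmap_comp. Qed.

Definition functor_comp (C D E : Category)
    (G : Functor D E) (F : Functor C D) : Functor C E :=
  @MkFunctor C E (fun X => G (F X)) (fun _ _ f => fmap G (fmap F f))
    (functor_comp_id G F) (functor_comp_comp G F).

Record NatTrans (C D : Category) (F G : Functor C D) := MkNatTrans {
  nt_app :> forall X : C, F X ~> G X;
  nt_natural : forall (X Y : C) (f : X ~> Y),
    nt_app Y ∘ fmap F f = fmap G f ∘ nt_app X }.

Definition is_nat_iso (C D : Category) (F G : Functor C D)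
    (t : NatTrans F G) : Prop :=
  forall X, is_iso (t X).

Definition is_isomorphism_of_categories (C D : Category) (F : Functor C D) : Prop :=
  exists G : Functor D C,
    functor_comp G F = functor_id C /\ functor_comp F G = functor_id D.

Definition is_equivalence_of_categories (C D : Category) (F : Functor C D) : Prop :=
  exists (G : Functor D C)
    (a : NatTrans (functor_comp G F) (functor_id C))
    (b : NatTrans (functor_comp F G) (functor_id D)),
    is_nat_iso a /\ is_nat_iso b.

Section CategoryLemmas.
Variables (C D : Category).

Lemma idhom_irr (X Y : C) (e e' : X = Y) : idhom e = idhom e'.
Proof. now rewrite (proof_irrelevance _ e e'). Qed.

Lemma idhom_id (X : C) (e : X = X) : idhom e = id X.
Proof. exact (idhom_irr e eq_refl). Qed.

Lemma idhom_comp (X Y Z : C) (e' : Y = Z) (e : X = Y) :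
  idhom e' ∘ idhom e = idhom (eq_trans e e').
Proof. destruct e'; simpl; apply comp_idl. Qed.

Lemma idhom_compA (X Y Z W : C) (e' : Z = W) (e : Y = Z) (f : X ~> Y) :
  idhom e' ∘ (idhom e ∘ f) = idhom (eq_trans e e') ∘ f.
Proof. now rewrite compA, idhom_comp. Qed.

Lemma idhom_symK (X Y : C) (e : X = Y) : idhom (eq_sym e) ∘ idhom e = id X.
Proof. rewrite idhom_comp; apply idhom_id. Qed.

Lemma idhom_Ksym (X Y : C) (e : X = Y) : idhom e ∘ idhom (eq_sym e) = id Y.
Proof. rewrite idhom_comp; apply idhom_id. Qed.

Lemma fmap_idhom (F : Functor C D) (X Y : C) (e : X = Y) :
  fmap F (idhom e) = idhom (f_equal F e).
Proof. destruct e; apply fmap_id. Qed.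

Lemma idhom_is_iso (X Y : C) (e : X = Y) : is_iso (idhom e).
Proof. exists (idhom (eq_sym e)); split; [apply idhom_symK | apply idhom_Ksym]. Qed.

Lemma is_iso_comp (X Y Z : C) (g : Y ~> Z) (f : X ~> Y) :
  is_iso g -> is_iso f -> is_iso (g ∘ f).
Proof.
intros [g' [g1 g2]] [f' [f1 f2]]; exists (f' ∘ g'); split.
- now rewrite compA, <- (compA f'), g1, comp_idr.
- now rewrite compA, <- (compA g), f2, comp_idr.
Qed.

End CategoryLemmas.

(* Strictness is equality of objects, together with the corresponding equality
   of morphisms; as the latter have only propositionally equal sources and
   targets, their equality is written with idhom. *)
Record StrictMonoidalCategory := MkStrictMonoidalCategory {
  smc_cat :> Category;
  tensor : smc_cat -> smc_cat -> smc_cat;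
  unit : smc_cat;
  tensor_hom : forall X X' Y Y' : smc_cat,
    X ~> X' -> Y ~> Y' -> tensor X Y ~> tensor X' Y';
  tensor_id : forall X Y : smc_cat, tensor_hom (id X) (id Y) = id (tensor X Y);
  tensor_comp : forall (X X' X'' Y Y' Y'' : smc_cat)
      (f' : X' ~> X'') (f : X ~> X') (g' : Y' ~> Y'') (g : Y ~> Y'),
    tensor_hom (f' ∘ f) (g' ∘ g) = tensor_hom f' g' ∘ tensor_hom f g;
  tensorA : forall X Y Z : smc_cat, tensor (tensor X Y) Z = tensor X (tensor Y Z);
  tensor1X : forall X : smc_cat, tensor unit X = X;
  tensorX1 : forall X : smc_cat, tensor X unit = X;
  tensor_homA : forall (X X' Y Y' Z Z' : smc_cat)
      (f : X ~> X') (g : Y ~> Y') (h : Z ~> Z'),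
    idhom (tensorA X' Y' Z') ∘ tensor_hom (tensor_hom f g) h
    = tensor_hom f (tensor_hom g h) ∘ idhom (tensorA X Y Z);
  tensor_hom1X : forall (X X' : smc_cat) (f : X ~> X'),
    idhom (tensor1X X') ∘ tensor_hom (id unit) f = f ∘ idhom (tensor1X X);
  tensor_homX1 : forall (X X' : smc_cat) (f : X ~> X'),
    idhom (tensorX1 X') ∘ tensor_hom f (id unit) = f ∘ idhom (tensorX1 X) }.

Arguments tensor {s} X Y.
Arguments unit {s}.
Arguments tensor_hom {s X X' Y Y'} f g.
Arguments tensorA {s} X Y Z.
Arguments tensor1X {s} X.
Arguments tensorX1 {s} X.

Notation "X ⊗ Y" := (tensor X Y) (at level 39, left associativity) : cat_scope.
Notation "f ⊠ g" := (tensor_hom f g) (at level 39, left associativity) : cat_scope.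
Notation "𝟙" := unit : cat_scope.

Section StructuralIdentities.
Variable C : StrictMonoidalCategory.
Implicit Types X Y Z : C.

Definition assoc X Y Z : (X ⊗ Y) ⊗ Z ~> X ⊗ (Y ⊗ Z) := idhom (tensorA X Y Z).
Definition assocV X Y Z : X ⊗ (Y ⊗ Z) ~> (X ⊗ Y) ⊗ Z := idhom (eq_sym (tensorA X Y Z)).
Definition lunit X : 𝟙 ⊗ X ~> X := idhom (tensor1X X).
Definition lunitV X : X ~> 𝟙 ⊗ X := idhom (eq_sym (tensor1X X)).
Definition runit X : X ⊗ 𝟙 ~> X := idhom (tensorX1 X).
Definition runitV X : X ~> X ⊗ 𝟙 := idhom (eq_sym (tensorX1 X)).

End StructuralIdentities.

Section MonoidalLemmas.
Variable C : StrictMonoidalCategory.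
Implicit Types X Y Z W : C.

Lemma tensor_compl X X' X'' Y (f' : X' ~> X'') (f : X ~> X') :
  (f' ∘ f) ⊠ id Y = (f' ⊠ id Y) ∘ (f ⊠ id Y).
Proof. now rewrite <- tensor_comp, comp_idl. Qed.

Lemma tensor_compr X Y Y' Y'' (g' : Y' ~> Y'') (g : Y ~> Y') :
  id X ⊠ (g' ∘ g) = (id X ⊠ g') ∘ (id X ⊠ g).
Proof. now rewrite <- tensor_comp, comp_idl. Qed.

Lemma tensor_idhoml X X' Y (e : X = X') :
  idhom e ⊠ id Y = idhom (f_equal (fun V => V ⊗ Y) e).
Proof. destruct e; apply tensor_id. Qed.

Lemma tensor_idhomr X Y Y' (e : Y = Y') :
  id X ⊠ idhom e = idhom (f_equal (fun V => X ⊗ V) e).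
Proof. destruct e; apply tensor_id. Qed.

Lemma tensor_assocE X X' Y Y' Z Z' (f : X ~> X') (g : Y ~> Y') (h : Z ~> Z') :
  (f ⊠ g) ⊠ h = idhom (eq_sym (tensorA X' Y' Z'))
                ∘ ((f ⊠ (g ⊠ h)) ∘ idhom (tensorA X Y Z)).
Proof. now rewrite <- tensor_homA, compA, idhom_symK, comp_idl. Qed.

Lemma tensor_ididE X Y Z Z' (h : Z ~> Z') :
  id X ⊠ (id Y ⊠ h) = idhom (tensorA X Y Z')
                      ∘ ((id (X ⊗ Y) ⊠ h) ∘ idhom (eq_sym (tensorA X Y Z))).
Proof. now rewrite <- tensor_id, compA, tensor_homA, <- compA, idhom_Ksym, comp_idr. Qed.

Lemma tensor_swap X X' Y Y' W (f : X ~> X') (g : Y ~> Y') (h : W ~> X ⊗ Y) :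
  (f ⊠ id Y') ∘ ((id X ⊠ g) ∘ h) = (id X' ⊠ g) ∘ ((f ⊠ id Y) ∘ h).
Proof. now rewrite !compA, <- !tensor_comp, !comp_idl, !comp_idr. Qed.

Lemma tensor_lunitE X X' (f : X ~> X') :
  id 𝟙 ⊠ f = idhom (eq_sym (tensor1X X')) ∘ (f ∘ idhom (tensor1X X)).
Proof. now rewrite <- tensor_hom1X, compA, idhom_symK, comp_idl. Qed.

Lemma tensor_runitE X X' (f : X ~> X') :
  f ⊠ id 𝟙 = idhom (eq_sym (tensorX1 X')) ∘ (f ∘ idhom (tensorX1 X)).
Proof. now rewrite <- tensor_homX1, compA, idhom_symK, comp_idl. Qed.

Lemma is_iso_tensor X X' Y Y' (f : X ~> X') (g : Y ~> Y') :
  is_iso f -> is_iso g -> is_iso (f ⊠ g).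
Proof.
intros [f' [f1 f2]] [g' [g1 g2]]; exists (f' ⊠ g'); split;
  rewrite <- tensor_comp, ?f1, ?f2, ?g1, ?g2; apply tensor_id.
Qed.

Lemma id_is_iso X : is_iso (id X).
Proof. exists (id X); split; apply comp_idl. Qed.

End MonoidalLemmas.

(* Compatibility with the structural isomorphisms is automatic here, all of
   them being identities. *)
Definition is_strict_monoidal (C D : StrictMonoidalCategory) (F : Functor C D) : Prop :=
  exists (e2 : forall X Y : C, F X ⊗ F Y = F (X ⊗ Y)) (e0 : 𝟙 = F 𝟙),
    forall (X X' Y Y' : C) (f : X ~> X') (g : Y ~> Y'),
      idhom (e2 X' Y') ∘ (fmap F f ⊠ fmap F g) = fmap F (f ⊠ g) ∘ idhom (e2 X Y).

Record Autonomous (C : StrictMonoidalCategory) := MkAutonomous {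
  ldual : C -> C;
  ev : forall X : C, ldual X ⊗ X ~> 𝟙;
  coev : forall X : C, 𝟙 ~> X ⊗ ldual X;
  ldual_zigzag1 : forall X : C,
    runit X ∘ (id X ⊠ ev X) ∘ assoc X (ldual X) X ∘ (coev X ⊠ id X) ∘ lunitV X = id X;
  ldual_zigzag2 : forall X : C,
    lunit (ldual X) ∘ (ev X ⊠ id (ldual X)) ∘ assocV (ldual X) X (ldual X)
      ∘ (id (ldual X) ⊠ coev X) ∘ runitV (ldual X) = id (ldual X);
  rdual : C -> C;
  rev : forall X : C, X ⊗ rdual X ~> 𝟙;
  rcoev : forall X : C, 𝟙 ~> rdual X ⊗ X;
  rdual_zigzag1 : forall X : C,
    lunit X ∘ (rev X ⊠ id X) ∘ assocV X (rdual X) X ∘ (id X ⊠ rcoev X) ∘ runitV X = id X;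
  rdual_zigzag2 : forall X : C,
    runit (rdual X) ∘ (id (rdual X) ⊠ rev X) ∘ assoc (rdual X) X (rdual X)
      ∘ (rcoev X ⊠ id (rdual X)) ∘ lunitV (rdual X) = id (rdual X) }.

Arguments ldual {C} a X : rename.
Arguments ev {C} a X : rename.
Arguments coev {C} a X : rename.
Arguments rdual {C} a X : rename.
Arguments rev {C} a X : rename.
Arguments rcoev {C} a X : rename.

Definition ldual_hom (C : StrictMonoidalCategory) (A : Autonomous C) (X Y : C)
    (f : X ~> Y) : ldual A Y ~> ldual A X :=
  lunit (ldual A X) ∘ (ev A Y ⊠ id (ldual A X)) ∘ assocV (ldual A Y) Y (ldual A X)
    ∘ (id (ldual A Y) ⊠ (f ⊠ id (ldual A X)))
    ∘ (id (ldual A Y) ⊠ coev A X) ∘ runitV (ldual A Y).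

Definition rdual_hom (C : StrictMonoidalCategory) (A : Autonomous C) (X Y : C)
    (f : X ~> Y) : rdual A Y ~> rdual A X :=
  runit (rdual A X) ∘ (id (rdual A X) ⊠ rev A Y) ∘ assoc (rdual A X) Y (rdual A Y)
    ∘ ((id (rdual A X) ⊠ f) ⊠ id (rdual A Y))
    ∘ (rcoev A X ⊠ id (rdual A Y)) ∘ lunitV (rdual A Y).

Record Comonoidal (C D : StrictMonoidalCategory) (F : Functor C D) := MkComonoidal {
  cm2 : forall X Y : C, F (X ⊗ Y) ~> F X ⊗ F Y;
  cm0 : F 𝟙 ~> 𝟙;
  cm2_natural : forall (X X' Y Y' : C) (f : X ~> X') (g : Y ~> Y'),
    cm2 X' Y' ∘ fmap F (f ⊠ g) = (fmap F f ⊠ fmap F g) ∘ cm2 X Y;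
  cm2_coassoc : forall X Y Z : C,
    assoc (F X) (F Y) (F Z) ∘ (cm2 X Y ⊠ id (F Z)) ∘ cm2 (X ⊗ Y) Z
    = (id (F X) ⊠ cm2 Y Z) ∘ cm2 X (Y ⊗ Z) ∘ fmap F (assoc X Y Z);
  cm2_counitl : forall X : C,
    lunit (F X) ∘ (cm0 ⊠ id (F X)) ∘ cm2 𝟙 X = fmap F (lunit X);
  cm2_counitr : forall X : C,
    runit (F X) ∘ (id (F X) ⊠ cm0) ∘ cm2 X 𝟙 = fmap F (runit X) }.

Definition comonoidal_id (C : StrictMonoidalCategory) : Comonoidal (functor_id C).
Proof.
refine (@MkComonoidal C C (functor_id C) (fun X Y => id (X ⊗ Y)) (id 𝟙) _ _ _ _); simpl.
- abstract (intros; now rewrite comp_idl, comp_idr).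
- abstract (intros; now rewrite !tensor_id, !comp_idr, comp_idl).
- abstract (intros; now rewrite tensor_id, !comp_idr).
- abstract (intros; now rewrite tensor_id, !comp_idr).
Defined.

Lemma cm2_natural_l (C D : StrictMonoidalCategory) (F : Functor C D)
    (cF : Comonoidal F) (X X' Y : C) (f : X ~> X') :
  (fmap F f ⊠ id (F Y)) ∘ cm2 cF X Y = cm2 cF X' Y ∘ fmap F (f ⊠ id Y).
Proof. now rewrite cm2_natural, fmap_id. Qed.

Lemma cm2_natural_r (C D : StrictMonoidalCategory) (F : Functor C D)
    (cF : Comonoidal F) (X Y Y' : C) (f : Y ~> Y') :
  (id (F X) ⊠ fmap F f) ∘ cm2 cF X Y = cm2 cF X Y' ∘ fmap F (id X ⊠ f).
Proof. now rewrite cm2_natural, fmap_id. Qed.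

Section ComonoidalComp.
Variables (C D E : StrictMonoidalCategory) (G : Functor D E) (F : Functor C D).
Variables (cG : Comonoidal G) (cF : Comonoidal F).

Let c2 (X Y : C) : G (F (X ⊗ Y)) ~> G (F X) ⊗ G (F Y) :=
  cm2 cG (F X) (F Y) ∘ fmap G (cm2 cF X Y).
Let c0 : G (F 𝟙) ~> 𝟙 := cm0 cG ∘ fmap G (cm0 cF).

Lemma comonoidal_comp_natural (X X' Y Y' : C) (f : X ~> X') (g : Y ~> Y') :
  c2 X' Y' ∘ fmap G (fmap F (f ⊠ g))
  = (fmap G (fmap F f) ⊠ fmap G (fmap F g)) ∘ c2 X Y.
Proof.
unfold c2.
now rewrite <- compA, <- fmap_comp, cm2_natural, fmap_comp, !compA, cm2_natural.
Qed.

Lemma comonoidal_comp_coassoc (X Y Z : C) :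
  assoc (G (F X)) (G (F Y)) (G (F Z)) ∘ (c2 X Y ⊠ id (G (F Z))) ∘ c2 (X ⊗ Y) Z
  = (id (G (F X)) ⊠ c2 Y Z) ∘ c2 X (Y ⊗ Z) ∘ fmap G (fmap F (assoc X Y Z)).
Proof.
unfold c2; rewrite tensor_compl, tensor_compr, !compA.
rewrite <- (compA _ (fmap G _ ⊠ id _)), cm2_natural_l, !compA, cm2_coassoc.
rewrite <- (compA _ (id _ ⊠ fmap G _)), cm2_natural_r, <- !compA.
now rewrite <- !fmap_comp, !compA, cm2_coassoc.
Qed.

Lemma comonoidal_comp_counitl (X : C) :
  lunit (G (F X)) ∘ (c0 ⊠ id (G (F X))) ∘ c2 𝟙 X = fmap G (fmap F (lunit X)).
Proof.
unfold c2, c0; rewrite tensor_compl, !compA.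
rewrite <- (compA _ (fmap G _ ⊠ id _)), cm2_natural_l, !compA, cm2_counitl.
now rewrite <- !fmap_comp, cm2_counitl.
Qed.

Lemma comonoidal_comp_counitr (X : C) :
  runit (G (F X)) ∘ (id (G (F X)) ⊠ c0) ∘ c2 X 𝟙 = fmap G (fmap F (runit X)).
Proof.
unfold c2, c0; rewrite tensor_compr, !compA.
rewrite <- (compA _ (id _ ⊠ fmap G _)), cm2_natural_r, !compA, cm2_counitr.
now rewrite <- !fmap_comp, cm2_counitr.
Qed.

Definition comonoidal_comp : Comonoidal (functor_comp G F) :=
  @MkComonoidal C E (functor_comp G F)
    (fun X Y => cm2 cG (F X) (F Y) ∘ fmap G (cm2 cF X Y))
    (cm0 cG ∘ fmap G (cm0 cF))
    comonoidal_comp_natural comonoidal_comp_coassoc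
    comonoidal_comp_counitl comonoidal_comp_counitr.

End ComonoidalComp.

Definition is_comonoidal_trans (C D : StrictMonoidalCategory) (F G : Functor C D)
    (cF : Comonoidal F) (cG : Comonoidal G) (t : NatTrans F G) : Prop :=
  (forall X Y : C, cm2 cG X Y ∘ t (X ⊗ Y) = (t X ⊠ t Y) ∘ cm2 cF X Y)
  /\ cm0 cG ∘ t 𝟙 = cm0 cF.

Record Monad (C : Category) (T : Functor C C) := MkMonad {
  mu : NatTrans (functor_comp T T) T;
  eta : NatTrans (functor_id C) T;
  muA : forall X : C, mu X ∘ fmap T (mu X) = mu X ∘ mu (T X);
  mu_etal : forall X : C, mu X ∘ eta (T X) = id (T X);
  mu_etar : forall X : C, mu X ∘ fmap T (eta X) = id (T X) }.

Record Bimonad (C : StrictMonoidalCategory) (T : Functor C C) := MkBimonad {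
  bm_monad :> Monad T;
  bm_comonoidal : Comonoidal T;
  mu_comonoidal : is_comonoidal_trans
    (comonoidal_comp bm_comonoidal bm_comonoidal) bm_comonoidal (mu bm_monad);
  eta_comonoidal : is_comonoidal_trans
    (comonoidal_id C) bm_comonoidal (eta bm_monad) }.

Section HopfMonad.
Variables (C : StrictMonoidalCategory) (A : Autonomous C).
Variables (T : Functor C C) (B : Bimonad T).
Let T2 := cm2 (bm_comonoidal B).
Let T0 := cm0 (bm_comonoidal B).

Record is_left_antipode (s : forall X : C, T (ldual A (T X)) ~> ldual A X) : Prop := {
  left_antipode_natural : forall (X Y : C) (f : X ~> Y),
    s X ∘ fmap T (ldual_hom A (fmap T f)) = ldual_hom A f ∘ s Y;
  left_antipode_ev : forall X : C,
    T0 ∘ fmap T (ev A X) ∘ fmap T (ldual_hom A (eta B X) ⊠ id X)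
    = ev A (T X) ∘ ((s (T X) ∘ fmap T (ldual_hom A (mu B X))) ⊠ id (T X))
        ∘ T2 (ldual A (T X)) X;
  left_antipode_coev : forall X : C,
    (eta B X ⊠ id (ldual A X)) ∘ coev A X ∘ T0
    = (mu B X ⊠ s X) ∘ T2 (T X) (ldual A (T X)) ∘ fmap T (coev A (T X)) }.

Record is_right_antipode (s : forall X : C, T (rdual A (T X)) ~> rdual A X) : Prop := {
  right_antipode_natural : forall (X Y : C) (f : X ~> Y),
    s X ∘ fmap T (rdual_hom A (fmap T f)) = rdual_hom A f ∘ s Y;
  right_antipode_ev : forall X : C,
    T0 ∘ fmap T (rev A X) ∘ fmap T (id X ⊠ rdual_hom A (eta B X))
    = rev A (T X) ∘ (id (T X) ⊠ (s (T X) ∘ fmap T (rdual_hom A (mu B X))))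
        ∘ T2 X (rdual A (T X));
  right_antipode_coev : forall X : C,
    (id (rdual A X) ⊠ eta B X) ∘ rcoev A X ∘ T0
    = (s X ⊠ mu B X) ∘ T2 (rdual A (T X)) (T X) ∘ fmap T (rcoev A (T X)) }.

Definition is_hopf_monad : Prop :=
  (exists s, is_left_antipode s) /\ (exists s, is_right_antipode s).

End HopfMonad.

Section Modules.
Variables (C : Category) (T : Functor C C) (m : Monad T).

Record TModule := MkModule {
  mod_ob : C;
  act : T mod_ob ~> mod_ob;
  act_mu : act ∘ fmap T act = act ∘ mu m mod_ob;
  act_eta : act ∘ eta m mod_ob = id mod_ob }.

Record ModuleHom (M N : TModule) := MkModuleHom {
  mod_hom : mod_ob M ~> mod_ob N;
  mod_hom_linear : mod_hom ∘ act M = act N ∘ fmap T mod_hom }.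

Arguments MkModuleHom {M N} mod_hom mod_hom_linear.

Lemma module_hom_eq (M N : TModule) (f g : ModuleHom M N) :
  mod_hom f = mod_hom g -> f = g.
Proof.
destruct f as [f p], g as [g q]; simpl; intros e; destruct e.
now rewrite (proof_irrelevance _ p q).
Qed.

Lemma module_id_linear (M : TModule) :
  id (mod_ob M) ∘ act M = act M ∘ fmap T (id (mod_ob M)).
Proof. now rewrite fmap_id, comp_idl, comp_idr. Qed.

Lemma module_comp_linear (M N P : TModule) (g : ModuleHom N P) (f : ModuleHom M N) :
  (mod_hom g ∘ mod_hom f) ∘ act M = act P ∘ fmap T (mod_hom g ∘ mod_hom f).
Proof.
now rewrite <- compA, (mod_hom_linear f), compA, (mod_hom_linear g), fmap_comp, compA.
Qed.

Definition module_id (M : TModule) : ModuleHom M M :=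
  MkModuleHom (id (mod_ob M)) (module_id_linear M).

Definition module_comp (M N P : TModule) (g : ModuleHom N P) (f : ModuleHom M N) :
    ModuleHom M P :=
  MkModuleHom (mod_hom g ∘ mod_hom f) (module_comp_linear g f).

Lemma module_comp_idl M N (f : ModuleHom M N) : module_comp (module_id N) f = f.
Proof. apply module_hom_eq, comp_idl. Qed.
Lemma module_comp_idr M N (f : ModuleHom M N) : module_comp f (module_id M) = f.
Proof. apply module_hom_eq, comp_idr. Qed.
Lemma module_compA M N P Q (h : ModuleHom P Q) (g : ModuleHom N P) (f : ModuleHom M N) :
  module_comp h (module_comp g f) = module_comp (module_comp h g) f.
Proof. apply module_hom_eq, compA. Qed.

Definition module_cat : Category :=
  @MkCategory TModule ModuleHom module_id module_comp
    module_comp_idl module_comp_idr module_compA.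

Lemma module_eq (M N : TModule) (e : mod_ob M = mod_ob N) :
  idhom e ∘ act M = act N ∘ fmap T (idhom e) -> M = N.
Proof.
destruct M as [M r p q], N as [N s p' q']; simpl in *; destruct e; simpl.
rewrite fmap_id, comp_idl, comp_idr; intros <-.
now rewrite (proof_irrelevance _ p p'), (proof_irrelevance _ q q').
Qed.

Lemma module_idhom (M N : module_cat) (e : M = N) :
  mod_hom (idhom e) = idhom (f_equal mod_ob e).
Proof. now destruct e. Qed.

End Modules.

Arguments MkModuleHom {C T m M N} mod_hom mod_hom_linear.
Arguments mod_ob {C T m} _.
Arguments act {C T m} _.

Section BimonadModules.
Variables (C : StrictMonoidalCategory) (T : Functor C C) (B : Bimonad T).
Let T2 := cm2 (bm_comonoidal B).
Let T0 := cm0 (bm_comonoidal B).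
Notation Mod := (module_cat B).

Lemma module_tensor_mu (M N : Mod) :
  let r := (act M ⊠ act N) ∘ T2 (mod_ob M) (mod_ob N) in
  r ∘ fmap T r = r ∘ mu B (mod_ob M ⊗ mod_ob N).
Proof.
simpl; destruct (mu_comonoidal B) as [h _]; simpl in h.
rewrite <- compA, <- (compA (_ ⊠ _)); unfold T2 at 1 3.
rewrite h, fmap_comp, (compA (cm2 _ _ _)), cm2_natural, !compA, <- !tensor_comp.
now rewrite !act_mu, <- !compA.
Qed.

Lemma module_tensor_eta (M N : Mod) :
  (act M ⊠ act N) ∘ T2 (mod_ob M) (mod_ob N) ∘ eta B (mod_ob M ⊗ mod_ob N)
  = id (mod_ob M ⊗ mod_ob N).
Proof.
destruct (eta_comonoidal B) as [h _]; simpl in h.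
pose proof (act_eta M) as hM; pose proof (act_eta N) as hN; simpl in hM, hN |- *.
rewrite <- compA; unfold T2; rewrite h, comp_idr, <- tensor_comp, hM, hN.
apply tensor_id.
Qed.

Definition module_tensor (M N : Mod) : Mod :=
  @MkModule C T B (mod_ob M ⊗ mod_ob N)
    ((act M ⊠ act N) ∘ cm2 (bm_comonoidal B) (mod_ob M) (mod_ob N))
    (module_tensor_mu M N) (module_tensor_eta M N).

Lemma module_unit_mu : T0 ∘ fmap T T0 = T0 ∘ mu B 𝟙.
Proof. symmetry; exact (proj2 (mu_comonoidal B)). Qed.
Lemma module_unit_eta : T0 ∘ eta B 𝟙 = id 𝟙.
Proof. exact (proj2 (eta_comonoidal B)). Qed.

Definition module_unit : Mod :=
  @MkModule C T B 𝟙 (cm0 (bm_comonoidal B)) module_unit_mu module_unit_eta.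

Lemma module_tensor_hom_linear (M M' N N' : Mod)
    (f : M ~> M') (g : N ~> N') :
  (mod_hom f ⊠ mod_hom g) ∘ act (module_tensor M N)
  = act (module_tensor M' N') ∘ fmap T (mod_hom f ⊠ mod_hom g).
Proof.
simpl; rewrite compA, <- tensor_comp, (mod_hom_linear f), (mod_hom_linear g), tensor_comp.
now rewrite <- !compA, cm2_natural.
Qed.

Definition module_tensor_hom (M M' N N' : Mod)
    (f : M ~> M') (g : N ~> N') : module_tensor M N ~> module_tensor M' N' :=
  @MkModuleHom C T B (module_tensor M N) (module_tensor M' N')
    (mod_hom f ⊠ mod_hom g) (module_tensor_hom_linear f g).

Lemma module_tensorA (M N P : Mod) :
  module_tensor (module_tensor M N) P = module_tensor M (module_tensor N P).
Proof.
apply (@module_eq _ _ _ (module_tensor (module_tensor M N) P)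
  (module_tensor M (module_tensor N P)) (tensorA (mod_ob M) (mod_ob N) (mod_ob P))).
simpl.
pose proof (cm2_coassoc (bm_comonoidal B) (mod_ob M) (mod_ob N) (mod_ob P)) as h.
unfold assoc in h.
rewrite <- (comp_idr (act P)) at 1; rewrite tensor_comp.
rewrite <- (comp_idr (act M)) at 2; rewrite tensor_comp.
rewrite !compA, tensor_homA, <- !compA; f_equal.
now rewrite !compA, h.
Qed.

Lemma module_tensor1X (M : Mod) : module_tensor module_unit M = M.
Proof.
apply (@module_eq _ _ _ (module_tensor module_unit M) M (tensor1X (mod_ob M))).
simpl.
pose proof (cm2_counitl (bm_comonoidal B) (mod_ob M)) as h; unfold lunit in h.
rewrite <- h, <- (comp_idl (cm0 _)) at 1; rewrite <- (comp_idr (act M)) at 1.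
now rewrite tensor_comp, !compA, tensor_hom1X.
Qed.

Lemma module_tensorX1 (M : Mod) : module_tensor M module_unit = M.
Proof.
apply (@module_eq _ _ _ (module_tensor M module_unit) M (tensorX1 (mod_ob M))).
simpl.
pose proof (cm2_counitr (bm_comonoidal B) (mod_ob M)) as h; unfold runit in h.
rewrite <- h, <- (comp_idl (cm0 _)) at 1; rewrite <- (comp_idr (act M)) at 1.
now rewrite tensor_comp, !compA, tensor_homX1.
Qed.

Lemma module_tensor_id (M N : Mod) :
  module_tensor_hom (id M) (id N) = id (module_tensor M N).
Proof. apply module_hom_eq, tensor_id. Qed.

Lemma module_tensor_comp (M M' M'' N N' N'' : Mod)
    (f' : M' ~> M'') (f : M ~> M') (g' : N' ~> N'') (g : N ~> N') :
  module_tensor_hom (f' ∘ f) (g' ∘ g)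
  = module_tensor_hom f' g' ∘ module_tensor_hom f g.
Proof. apply module_hom_eq, tensor_comp. Qed.

Lemma module_tensor_homA (M M' N N' P P' : Mod)
    (f : M ~> M') (g : N ~> N') (h : P ~> P') :
  idhom (module_tensorA M' N' P') ∘ module_tensor_hom (module_tensor_hom f g) h
  = module_tensor_hom f (module_tensor_hom g h) ∘ idhom (module_tensorA M N P).
Proof.
apply module_hom_eq; simpl; rewrite !module_idhom.
rewrite (idhom_irr _ (tensorA (mod_ob M') (mod_ob N') (mod_ob P'))), tensor_homA.
f_equal; apply idhom_irr.
Qed.

Lemma module_tensor_hom1X (M M' : Mod) (f : M ~> M') :
  idhom (module_tensor1X M') ∘ module_tensor_hom (id module_unit) f
  = f ∘ idhom (module_tensor1X M).
Proof.
apply module_hom_eq; simpl; rewrite !module_idhom.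
rewrite (idhom_irr _ (tensor1X (mod_ob M'))), tensor_hom1X.
f_equal; apply idhom_irr.
Qed.

Lemma module_tensor_homX1 (M M' : Mod) (f : M ~> M') :
  idhom (module_tensorX1 M') ∘ module_tensor_hom f (id module_unit)
  = f ∘ idhom (module_tensorX1 M).
Proof.
apply module_hom_eq; simpl; rewrite !module_idhom.
rewrite (idhom_irr _ (tensorX1 (mod_ob M'))), tensor_homX1.
f_equal; apply idhom_irr.
Qed.

Definition module_smc : StrictMonoidalCategory :=
  @MkStrictMonoidalCategory (module_cat B) module_tensor module_unit module_tensor_hom
    module_tensor_id module_tensor_comp module_tensorA module_tensor1X module_tensorX1
    module_tensor_homA module_tensor_hom1X module_tensor_homX1.

End BimonadModules.

Record is_half_braiding (C : StrictMonoidalCategory) (M : C)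
    (s : forall Y : C, M ⊗ Y ~> Y ⊗ M) : Prop := {
  hb_natural : forall (Y Y' : C) (f : Y ~> Y'), s Y' ∘ (id M ⊠ f) = (f ⊠ id M) ∘ s Y;
  hb_iso : forall Y : C, is_iso (s Y);
  hb_tensor : forall Y Z : C,
    s (Y ⊗ Z) = assocV Y Z M ∘ (id Y ⊠ s Z) ∘ assoc Y M Z ∘ (s Y ⊠ id Z) ∘ assocV M Y Z;
  hb_unit : lunit M ∘ s 𝟙 = runit M }.

Section Center.
Variable C : StrictMonoidalCategory.

Record CenterOb := MkCenterOb {
  cen_ob : C;
  braid : forall Y : C, cen_ob ⊗ Y ~> Y ⊗ cen_ob;
  braid_half : is_half_braiding braid }.

Record CenterHom (M N : CenterOb) := MkCenterHom {
  cen_hom : cen_ob M ~> cen_ob N;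
  cen_hom_braid : forall Y : C,
    (id Y ⊠ cen_hom) ∘ braid M Y = braid N Y ∘ (cen_hom ⊠ id Y) }.

Arguments MkCenterHom {M N} cen_hom cen_hom_braid.

Lemma center_hom_eq (M N : CenterOb) (f g : CenterHom M N) :
  cen_hom f = cen_hom g -> f = g.
Proof.
destruct f as [f p], g as [g q]; simpl; intros e; destruct e.
now rewrite (proof_irrelevance _ p q).
Qed.

Lemma center_id_braid (M : CenterOb) (Y : C) :
  (id Y ⊠ id (cen_ob M)) ∘ braid M Y = braid M Y ∘ (id (cen_ob M) ⊠ id Y).
Proof. now rewrite !tensor_id, comp_idl, comp_idr. Qed.

Lemma center_comp_braid (M N P : CenterOb) (g : CenterHom N P) (f : CenterHom M N)
    (Y : C) :
  (id Y ⊠ (cen_hom g ∘ cen_hom f)) ∘ braid M Y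
  = braid P Y ∘ ((cen_hom g ∘ cen_hom f) ⊠ id Y).
Proof.
now rewrite tensor_compl, tensor_compr, <- compA, cen_hom_braid, compA,
  cen_hom_braid, compA.
Qed.

Definition center_id (M : CenterOb) : CenterHom M M :=
  MkCenterHom (id (cen_ob M)) (center_id_braid M).

Definition center_comp (M N P : CenterOb) (g : CenterHom N P) (f : CenterHom M N) :
    CenterHom M P :=
  MkCenterHom (cen_hom g ∘ cen_hom f) (center_comp_braid g f).

Lemma center_comp_idl M N (f : CenterHom M N) : center_comp (center_id N) f = f.
Proof. apply center_hom_eq, comp_idl. Qed.
Lemma center_comp_idr M N (f : CenterHom M N) : center_comp f (center_id M) = f.
Proof. apply center_hom_eq, comp_idr. Qed.
Lemma center_compA M N P Q (h : CenterHom P Q) (g : CenterHom N P) (f : CenterHom M N) :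
  center_comp h (center_comp g f) = center_comp (center_comp h g) f.
Proof. apply center_hom_eq, compA. Qed.

Definition center_cat : Category :=
  @MkCategory CenterOb CenterHom center_id center_comp
    center_comp_idl center_comp_idr center_compA.

Lemma center_eq (M N : CenterOb) (e : cen_ob M = cen_ob N) :
  (forall Y, (id Y ⊠ idhom e) ∘ braid M Y = braid N Y ∘ (idhom e ⊠ id Y)) -> M = N.
Proof.
destruct M as [M s p], N as [N t q]; simpl in *; destruct e; simpl; intros h.
assert (e : s = t).
{ apply functional_extensionality_dep; intros Y; specialize (h Y).
  now rewrite !tensor_id, comp_idl, comp_idr in h. }
destruct e; now rewrite (proof_irrelevance _ p q).
Qed.

Lemma center_idhom (M N : center_cat) (e : M = N) :
  cen_hom (idhom e) = idhom (f_equal cen_ob e).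
Proof. now destruct e. Qed.

End Center.

Arguments MkCenterHom {C M N} cen_hom cen_hom_braid.

Ltac casts :=
  unfold assoc, assocV, lunit, lunitV, runit, runitV;
  repeat rewrite ?tensor_compl, ?tensor_compr, ?tensor_idhoml, ?tensor_idhomr,
    ?tensor_id, <- ?compA, ?idhom_compA, ?idhom_comp;
  repeat match goal with
  | |- context [@idhom _ ?X ?X ?e] => rewrite (idhom_id e)
  end; rewrite ?comp_idl, ?comp_idr.

Ltac cast_irr := repeat (apply idhom_irr || reflexivity || f_equal).

Section CenterMonoidal.
Variable C : StrictMonoidalCategory.
Notation Cen := (center_cat C).

Definition center_tensor_braid (M N : Cen) (Y : C) :
    (cen_ob M ⊗ cen_ob N) ⊗ Y ~> Y ⊗ (cen_ob M ⊗ cen_ob N) :=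
  assoc Y (cen_ob M) (cen_ob N) ∘ (braid M Y ⊠ id (cen_ob N))
    ∘ assocV (cen_ob M) Y (cen_ob N) ∘ (id (cen_ob M) ⊠ braid N Y)
    ∘ assoc (cen_ob M) (cen_ob N) Y.

Lemma assoc_natural (X X' Y Y' Z Z' : C) (f : X ~> X') (g : Y ~> Y') (h : Z ~> Z') :
  assoc X' Y' Z' ∘ ((f ⊠ g) ⊠ h) = (f ⊠ (g ⊠ h)) ∘ assoc X Y Z.
Proof. apply tensor_homA. Qed.

Lemma assocV_natural (X X' Y Y' Z Z' : C) (f : X ~> X') (g : Y ~> Y') (h : Z ~> Z') :
  assocV X' Y' Z' ∘ (f ⊠ (g ⊠ h)) = ((f ⊠ g) ⊠ h) ∘ assocV X Y Z.
Proof. unfold assocV; now rewrite tensor_assocE, <- !compA, idhom_Ksym, comp_idr. Qed.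

Lemma center_tensor_natural (M N : Cen) (Y Y' : C) (f : Y ~> Y') :
  center_tensor_braid M N Y' ∘ (id (cen_ob M ⊗ cen_ob N) ⊠ f)
  = (f ⊠ id (cen_ob M ⊗ cen_ob N)) ∘ center_tensor_braid M N Y.
Proof.
unfold center_tensor_braid.
rewrite <- !tensor_id, <- (compA _ (assoc _ _ Y')), assoc_natural, !compA.
rewrite <- (compA _ (id _ ⊠ braid N Y')), <- tensor_compr, (hb_natural (braid_half N)).
rewrite tensor_compr, !compA, <- (compA _ (assocV _ _ _)), assocV_natural, !compA.
rewrite <- (compA _ (braid M Y' ⊠ _)), <- tensor_compl, (hb_natural (braid_half M)).
now rewrite tensor_compl, !compA, assoc_natural.
Qed.

Lemma center_tensor_iso (M N : Cen) (Y : C) : is_iso (center_tensor_braid M N Y).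
Proof.
unfold center_tensor_braid; repeat apply is_iso_comp; try apply idhom_is_iso;
  apply is_iso_tensor; try apply id_is_iso; apply hb_iso, braid_half.
Qed.

Lemma center_tensor_tensor (M N : Cen) (Y Z : C) :
  center_tensor_braid M N (Y ⊗ Z)
  = assocV Y Z (cen_ob M ⊗ cen_ob N) ∘ (id Y ⊠ center_tensor_braid M N Z)
    ∘ assoc Y (cen_ob M ⊗ cen_ob N) Z ∘ (center_tensor_braid M N Y ⊠ id Z)
    ∘ assocV (cen_ob M ⊗ cen_ob N) Y Z.
Proof.
unfold center_tensor_braid.
rewrite (hb_tensor (braid_half M)), (hb_tensor (braid_half N)).
casts; rewrite !tensor_assocE; casts; rewrite !tensor_ididE; casts.
rewrite tensor_swap; cast_irr.
Qed.

Lemma center_tensor_unit (M N : Cen) :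
  lunit (cen_ob M ⊗ cen_ob N) ∘ center_tensor_braid M N 𝟙 = runit (cen_ob M ⊗ cen_ob N).
Proof.
unfold center_tensor_braid.
assert (h : forall P : Cen, braid P 𝟙 = lunitV (cen_ob P) ∘ runit (cen_ob P)).
{ intros P; rewrite <- (hb_unit (braid_half P)); casts; reflexivity. }
rewrite !h; casts; apply idhom_irr.
Qed.

Definition center_tensor (M N : Cen) : Cen :=
  MkCenterOb (Build_is_half_braiding (@center_tensor_natural M N)
    (@center_tensor_iso M N) (@center_tensor_tensor M N) (@center_tensor_unit M N)).

Definition center_unit_braid (Y : C) : 𝟙 ⊗ Y ~> Y ⊗ 𝟙 := runitV Y ∘ lunit Y.

Lemma center_unit_half : is_half_braiding center_unit_braid.
Proof.
unfold center_unit_braid; split.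
- intros Y Y' f; rewrite tensor_lunitE, tensor_runitE; casts; cast_irr.
- intros Y; apply is_iso_comp; apply idhom_is_iso.
- intros Y Z; casts; cast_irr.
- casts; cast_irr.
Qed.

Definition center_unit : Cen := MkCenterOb center_unit_half.

Lemma center_tensor_hom_braid (M M' N N' : Cen) (f : M ~> M') (g : N ~> N') (Y : C) :
  (id Y ⊠ (cen_hom f ⊠ cen_hom g)) ∘ braid (center_tensor M N) Y
  = braid (center_tensor M' N') Y ∘ ((cen_hom f ⊠ cen_hom g) ⊠ id Y).
Proof.
simpl; unfold center_tensor_braid.
assert (e1 : ((id Y ⊠ cen_hom f) ⊠ cen_hom g) ∘ (braid M Y ⊠ id (cen_ob N))
  = (braid M' Y ⊠ id (cen_ob N')) ∘ ((cen_hom f ⊠ id Y) ⊠ cen_hom g)).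
{ now rewrite <- !tensor_comp, cen_hom_braid, comp_idl, comp_idr. }
assert (e2 : (cen_hom f ⊠ (id Y ⊠ cen_hom g)) ∘ (id (cen_ob M) ⊠ braid N Y)
  = (id (cen_ob M') ⊠ braid N' Y) ∘ (cen_hom f ⊠ (cen_hom g ⊠ id Y))).
{ now rewrite <- !tensor_comp, cen_hom_braid, comp_idl, comp_idr. }
rewrite !compA, <- assoc_natural, <- (compA (assoc _ _ _)), e1, <- !compA.
rewrite (compA (_ ⊠ cen_hom g)), <- assocV_natural, <- !compA.
now rewrite (compA (cen_hom f ⊠ _)), e2, <- !compA, assoc_natural.
Qed.

Definition center_tensor_hom (M M' N N' : Cen) (f : M ~> M') (g : N ~> N') :
    center_tensor M N ~> center_tensor M' N' :=
  @MkCenterHom C (center_tensor M N) (center_tensor M' N')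
    (cen_hom f ⊠ cen_hom g) (center_tensor_hom_braid f g).

Lemma center_tensorA (M N P : Cen) :
  center_tensor (center_tensor M N) P = center_tensor M (center_tensor N P).
Proof.
apply (@center_eq _ (center_tensor (center_tensor M N) P)
  (center_tensor M (center_tensor N P)) (tensorA (cen_ob M) (cen_ob N) (cen_ob P))).
intros Y; simpl; unfold center_tensor_braid; simpl; unfold center_tensor_braid.
casts; rewrite !tensor_assocE; casts; rewrite !tensor_ididE; casts; cast_irr.
Qed.

Lemma center_tensor1X (M : Cen) : center_tensor center_unit M = M.
Proof.
apply (@center_eq _ (center_tensor center_unit M) M (tensor1X (cen_ob M))).
intros Y; simpl; unfold center_tensor_braid; simpl; unfold center_unit_braid.
casts; rewrite tensor_lunitE; casts; cast_irr.
Qed.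

Lemma center_tensorX1 (M : Cen) : center_tensor M center_unit = M.
Proof.
apply (@center_eq _ (center_tensor M center_unit) M (tensorX1 (cen_ob M))).
intros Y; simpl; unfold center_tensor_braid; simpl; unfold center_unit_braid.
casts; rewrite tensor_runitE; casts; cast_irr.
Qed.

Lemma center_tensor_id (M N : Cen) :
  center_tensor_hom (id M) (id N) = id (center_tensor M N).
Proof. apply center_hom_eq, tensor_id. Qed.

Lemma center_tensor_comp (M M' M'' N N' N'' : Cen)
    (f' : M' ~> M'') (f : M ~> M') (g' : N' ~> N'') (g : N ~> N') :
  center_tensor_hom (f' ∘ f) (g' ∘ g)
  = center_tensor_hom f' g' ∘ center_tensor_hom f g.
Proof. apply center_hom_eq, tensor_comp. Qed.

Lemma center_tensor_homA (M M' N N' P P' : Cen)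
    (f : M ~> M') (g : N ~> N') (h : P ~> P') :
  idhom (center_tensorA M' N' P') ∘ center_tensor_hom (center_tensor_hom f g) h
  = center_tensor_hom f (center_tensor_hom g h) ∘ idhom (center_tensorA M N P).
Proof.
apply center_hom_eq; simpl; rewrite !center_idhom.
rewrite (idhom_irr _ (tensorA (cen_ob M') (cen_ob N') (cen_ob P'))), tensor_homA.
f_equal; apply idhom_irr.
Qed.

Lemma center_tensor_hom1X (M M' : Cen) (f : M ~> M') :
  idhom (center_tensor1X M') ∘ center_tensor_hom (id center_unit) f
  = f ∘ idhom (center_tensor1X M).
Proof.
apply center_hom_eq; simpl; rewrite !center_idhom.
rewrite (idhom_irr _ (tensor1X (cen_ob M'))), tensor_hom1X.
f_equal; apply idhom_irr.
Qed.

Lemma center_tensor_homX1 (M M' : Cen) (f : M ~> M') :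
  idhom (center_tensorX1 M') ∘ center_tensor_hom f (id center_unit)
  = f ∘ idhom (center_tensorX1 M).
Proof.
apply center_hom_eq; simpl; rewrite !center_idhom.
rewrite (idhom_irr _ (tensorX1 (cen_ob M'))), tensor_homX1.
f_equal; apply idhom_irr.
Qed.

Definition center_smc : StrictMonoidalCategory :=
  @MkStrictMonoidalCategory Cen center_tensor center_unit center_tensor_hom
    center_tensor_id center_tensor_comp center_tensorA center_tensor1X center_tensorX1
    center_tensor_homA center_tensor_hom1X center_tensor_homX1.

Definition center_forget : Functor Cen C :=
  @MkFunctor Cen C (@cen_ob C) (fun M N f => cen_hom f)
    (fun _ => eq_refl) (fun _ _ _ _ _ => eq_refl).

End CenterMonoidal.

Record Adjunction (C D : Category) (F : Functor C D) (U : Functor D C) := MkAdjunction {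
  adj_unit : NatTrans (functor_id C) (functor_comp U F);
  adj_counit : NatTrans (functor_comp F U) (functor_id D);
  adj_triangle1 : forall X : C, adj_counit (F X) ∘ fmap F (adj_unit X) = id (F X);
  adj_triangle2 : forall Y : D, fmap U (adj_counit Y) ∘ adj_unit (U Y) = id (U Y) }.

Section Comparison.
Variables (C D : Category) (F : Functor C D) (U : Functor D C) (a : Adjunction F U).

Lemma adj_mu_natural (X Y : C) (f : X ~> Y) :
  fmap U (adj_counit a (F Y)) ∘ fmap (functor_comp (functor_comp U F) (functor_comp U F)) f
  = fmap (functor_comp U F) f ∘ fmap U (adj_counit a (F X)).
Proof.
simpl; rewrite <- !fmap_comp; f_equal.
exact (nt_natural (adj_counit a) (fmap F f)).
Qed.

Definition adj_mu :
    NatTrans (functor_comp (functor_comp U F) (functor_comp U F)) (functor_comp U F) :=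
  @MkNatTrans C C (functor_comp (functor_comp U F) (functor_comp U F)) (functor_comp U F)
    (fun X => fmap U (adj_counit a (F X))) adj_mu_natural.

Lemma adj_muA (X : C) :
  adj_mu X ∘ fmap (functor_comp U F) (adj_mu X) = adj_mu X ∘ adj_mu (functor_comp U F X).
Proof.
simpl; rewrite <- !fmap_comp; f_equal.
exact (nt_natural (adj_counit a) (adj_counit a (F X))).
Qed.

Lemma adj_mu_etal (X : C) :
  adj_mu X ∘ adj_unit a (functor_comp U F X) = id (functor_comp U F X).
Proof. exact (adj_triangle2 a (F X)). Qed.

Lemma adj_mu_etar (X : C) :
  adj_mu X ∘ fmap (functor_comp U F) (adj_unit a X) = id (functor_comp U F X).
Proof.
simpl; rewrite <- fmap_comp; pose proof (adj_triangle1 a X) as h; simpl in h |- *.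
now rewrite h, fmap_id.
Qed.

Definition adj_monad : Monad (functor_comp U F) :=
  @MkMonad C (functor_comp U F) adj_mu (adj_unit a) adj_muA adj_mu_etal adj_mu_etar.

Lemma comparison_act_mu (Y : D) :
  fmap U (adj_counit a Y) ∘ fmap (functor_comp U F) (fmap U (adj_counit a Y))
  = fmap U (adj_counit a Y) ∘ mu adj_monad (U Y).
Proof.
simpl; rewrite <- !fmap_comp; f_equal.
exact (nt_natural (adj_counit a) (adj_counit a Y)).
Qed.

Definition comparison_ob (Y : D) : module_cat adj_monad :=
  @MkModule C (functor_comp U F) adj_monad (U Y) (fmap U (adj_counit a Y))
    (comparison_act_mu Y) (adj_triangle2 a Y).

Lemma comparison_hom_linear (X Y : D) (f : X ~> Y) :
  fmap U f ∘ act (comparison_ob X)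
  = act (comparison_ob Y) ∘ fmap (functor_comp U F) (fmap U f).
Proof.
simpl; rewrite <- !fmap_comp; f_equal.
symmetry; exact (nt_natural (adj_counit a) f).
Qed.

Definition comparison_hom (X Y : D) (f : X ~> Y) : comparison_ob X ~> comparison_ob Y :=
  @MkModuleHom _ _ adj_monad (comparison_ob X) (comparison_ob Y)
    (fmap U f) (comparison_hom_linear f).

Lemma comparison_id (X : D) : comparison_hom (id X) = id (comparison_ob X).
Proof. apply module_hom_eq, fmap_id. Qed.

Lemma comparison_comp (X Y Z : D) (g : Y ~> Z) (f : X ~> Y) :
  comparison_hom (g ∘ f) = comparison_hom g ∘ comparison_hom f.
Proof. apply module_hom_eq, fmap_comp. Qed.

Definition comparison : Functor D (module_cat adj_monad) :=
  MkFunctor comparison_id comparison_comp.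

End Comparison.

Record is_monad_iso (C : Category) (T T' : Functor C C) (m : Monad T) (m' : Monad T')
    (t : NatTrans T T') : Prop := {
  monad_iso_iso : is_nat_iso t;
  monad_iso_mu : forall X : C, t X ∘ mu m X = mu m' X ∘ (t (T' X) ∘ fmap T (t X));
  monad_iso_eta : forall X : C, t X ∘ eta m X = eta m' X }.

(* The monad of a monadic functor being defined up to isomorphism only, "with
   monad m" means that m is isomorphic to the monad of an adjunction F ⊣ U. *)
Definition is_monadic_with_monad (C D : Category) (U : Functor D C)
    (T : Functor C C) (m : Monad T) : Prop :=
  exists (F : Functor C D) (a : Adjunction F U),
    is_equivalence_of_categories (comparison a)
    /\ exists t : NatTrans (functor_comp U F) T, is_monad_iso (adj_monad a) m t.

Record is_centralizer (C : StrictMonoidalCategory) (Z : Functor C C)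
    (d : forall X Y : C, X ⊗ Y ~> Y ⊗ Z X) : Prop := {
  centralizer_natural : forall (X X' Y Y' : C) (f : X ~> X') (g : Y ~> Y'),
    d X' Y' ∘ (f ⊠ g) = (g ⊠ fmap Z f) ∘ d X Y;
  centralizer_universal : forall (X W : C) (xi : forall Y : C, X ⊗ Y ~> Y ⊗ W),
    (forall (Y Y' : C) (g : Y ~> Y'), xi Y' ∘ (id X ⊠ g) = (g ⊠ id W) ∘ xi Y) ->
    exists! r : Z X ~> W, forall Y : C, xi Y = (id Y ⊠ r) ∘ d X Y }.

Section Centralizer.
Variables (C : StrictMonoidalCategory) (Z : Functor C C).
Variable d : forall X Y : C, X ⊗ Y ~> Y ⊗ Z X.

Record is_centralizer_bimonad (B : Bimonad Z) : Prop := {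
  centralizer_mu : forall X Y1 Y2 : C,
    (id (Y1 ⊗ Y2) ⊠ mu B X) ∘ assocV Y1 Y2 (Z (Z X)) ∘ (id Y1 ⊠ d (Z X) Y2)
      ∘ assoc Y1 (Z X) Y2 ∘ (d X Y1 ⊠ id Y2)
    = d X (Y1 ⊗ Y2) ∘ assoc X Y1 Y2;
  centralizer_eta : forall X : C,
    eta B X = lunit (Z X) ∘ d X 𝟙 ∘ runitV X;
  centralizer_cm2 : forall X1 X2 Y : C,
    (id Y ⊠ cm2 (bm_comonoidal B) X1 X2) ∘ d (X1 ⊗ X2) Y
    = assoc Y (Z X1) (Z X2) ∘ (d X1 Y ⊠ id (Z X2)) ∘ assocV X1 Y (Z X2)
        ∘ (id X1 ⊠ d X2 Y) ∘ assoc X1 X2 Y;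
  centralizer_cm0 : forall Y : C,
    runit Y ∘ (id Y ⊠ cm0 (bm_comonoidal B)) ∘ d 𝟙 Y = lunit Y }.

Variables (dZ : is_centralizer d) (B : Bimonad Z).

Definition action_braid (M : module_cat B) (Y : C) : mod_ob M ⊗ Y ~> Y ⊗ mod_ob M :=
  (id Y ⊠ act M) ∘ d (mod_ob M) Y.

Lemma action_braid_hom (M N : module_cat B) (f : M ~> N) (Y : C) :
  (id Y ⊠ mod_hom f) ∘ action_braid M Y = action_braid N Y ∘ (mod_hom f ⊠ id Y).
Proof.
unfold action_braid; rewrite <- compA, (centralizer_natural dZ), !compA.
now rewrite <- !tensor_compr, mod_hom_linear.
Qed.

(* The functor (M, r) |-> (M, {(id_Y ⊗ r) d_{M,Y}}_Y), f |-> f; that its values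
   on objects are half braidings is the hypothesis hb. *)
Variable hb : forall M : module_cat B, is_half_braiding (action_braid M).

Definition module_to_center_ob (M : module_cat B) : center_cat C := MkCenterOb (hb M).

Definition module_to_center_hom (M N : module_cat B) (f : M ~> N) :
    module_to_center_ob M ~> module_to_center_ob N :=
  @MkCenterHom C (module_to_center_ob M) (module_to_center_ob N)
    (mod_hom f) (action_braid_hom f).

Lemma module_to_center_id (M : module_cat B) :
  module_to_center_hom (id M) = id (module_to_center_ob M).
Proof. now apply center_hom_eq. Qed.

Lemma module_to_center_comp (M N P : module_cat B) (g : N ~> P) (f : M ~> N) :
  module_to_center_hom (g ∘ f) = module_to_center_hom g ∘ module_to_center_hom f.
Proof. now apply center_hom_eq. Qed.

Definition module_to_center : Functor (module_smc B) (center_smc C) :=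
  @MkFunctor (module_smc B) (center_smc C) module_to_center_ob module_to_center_hom
    module_to_center_id module_to_center_comp.

End Centralizer.

(* Main.v *)
(* A natural family X ⊗ Y -> Y ⊗ W is the same as a morphism Z X -> W, and, moving
   factors across tensor products with duals, families natural in several
   variables Y1, ..., Yn correspond to morphisms out of the n-fold iterate Z ... Z X.
   Under this correspondence the product of Z is the family d_{X, Y1 ⊗ Y2}, and every
   bimonad axiom is an equality of families.  A Z-action r on M is the same as a
   natural family M ⊗ Y -> Y ⊗ M; the module axioms say exactly that it is
   multiplicative and unital in Y, and such a family is automatically invertible
   because Y has a right dual, hence is a half braiding.  The forgetful functor of the
   center is then, up to an isomorphism of categories, that of Z-modules.  For the
   antipodes, half braidings pass to the duals of M; if rho is the resulting action on
   the dual of the free module Z X, the antipode at X is (dual of eta_X) ∘ rho. *)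

(* The universal property tests only arrows out of [Z X], whereas the bimonad laws also involve
   arrows out of iterates of [Z]. Testing an arrow out of [Z (Z X)] against one variable leaves an
   equation between arrows out of [Z X ⊗ Y], so the universal property is needed with a spectator
   factor on the right; bending that factor away along its left dual provides it. Duals thus enter
   already in the bimonad structure. The antipode axioms come from linearity: evaluation and
   coevaluation of the free module on [X] are linear for the dual action, because transposition
   turns a half braiding on the dual into the inverse of the free one. Composing these statements
   with [eta] or its dual gives the axioms; in the evaluation axioms the triangle [mu ∘ Z eta = id]
   removes the free action. *)
From Stdlib Require Import ProofIrrelevance FunctionalExtensionality ClassicalEpsilon.
Require Import Defs.
Local Open Scope cat_scope.
Set Implicit Arguments.
Unset Strict Implicit.

(* Strictness of the monoidal structure is only an equality of objects, so that typed
   equations are cluttered with idhom.  Forgetting sources and targets, the tensor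
   product becomes strictly associative and unital, casts become identities, and
   composition becomes a total operation, with None for non-composable pairs; it
   remains associative without side conditions. *)
Record typed_arrow (C : Category) := TypedArrow {
  src : C; tgt : C; mor : src ~> tgt }.
Arguments TypedArrow {C src tgt} mor.

Definition arrow (C : Category) := option (typed_arrow C).

Definition arr (C : Category) (X Y : C) (f : X ~> Y) : arrow C := Some (TypedArrow f).
Definition ida (C : Category) (X : C) : arrow C := arr (id X).

(** Equality of objects need not be decidable, so composability is decided classically. *)
Definition cmp (C : Category) (a b : arrow C) : arrow C :=
  match a, b with
  | Some g, Some f =>
      match excluded_middle_informative (tgt f = src g) with
      | left e => arr (mor g ∘ (idhom e ∘ mor f))
      | right _ => None
      end
  | _, _ => None
  end.

Definition tens (C : StrictMonoidalCategory) (a b : arrow C) : arrow C :=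
  match a, b with
  | Some f, Some g => arr (mor f ⊠ mor g)
  | _, _ => None
  end.

Definition lw (C : StrictMonoidalCategory) (X : C) (a : arrow C) : arrow C := tens (ida X) a.
Definition rw (C : StrictMonoidalCategory) (a : arrow C) (X : C) : arrow C := tens a (ida X).

(** [None] has no type, so [ty] also asserts definedness. *)
Definition ty (C : Category) (a : arrow C) (X Y : C) : Prop :=
  exists f : X ~> Y, a = arr f.

Declare Scope arrow_scope.
Notation "a ∙ b" := (cmp a b) (at level 40, left associativity) : arrow_scope.
Notation "a ⊙ b" := (tens a b) (at level 39, left associativity) : arrow_scope.
Notation "X ▹ a" := (lw X a) (at level 38, right associativity) : arrow_scope.
Notation "a ◃ X" := (rw a X) (at level 37, left associativity) : arrow_scope.
Local Open Scope arrow_scope.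

(** * Laws of untyped composition, tensor product and whiskering *)

Section Arrows.
Variable C : Category.
Implicit Types (X Y : C) (a b c : arrow C).

(** Turns an equation decorated with casts, the form of the strictness axioms, into a bare equality
    of arrows. *)
Lemma arr_eq X X' Y Y' (f : X ~> Y) (g : X' ~> Y') (e : X = X') (e' : Y = Y') :
  idhom e' ∘ f = g ∘ idhom e -> arr f = arr g.
Proof.
destruct e, e'; simpl; rewrite comp_idl, comp_idr; now intros ->.
Qed.

(** The way back to typed morphisms; source and target are dependent components, removed one at a
    time by [inj_pair2]. *)
Lemma arr_inj X Y (f g : X ~> Y) : arr f = arr g -> f = g.
Proof.
intros h; injection h; intros h'.
apply inj_pair2 in h'; now apply inj_pair2 in h'.
Qed.

Lemma arr_comp X Y Z (g : Y ~> Z) (f : X ~> Y) : arr (g ∘ f) = arr g ∙ arr f.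
Proof.
simpl; destruct (excluded_middle_informative _) as [e | n]; [| now destruct n].
now rewrite idhom_id, comp_idl.
Qed.

(** No typing is required: a mismatch at either joint makes both bracketings [None]. *)
Lemma cmpA a b c : a ∙ (b ∙ c) = a ∙ b ∙ c.
Proof.
destruct a as [[X X' f]|], b as [[Y Y' g]|], c as [[V V' h]|]; try reflexivity; simpl.
2: now destruct (excluded_middle_informative _).
destruct (excluded_middle_informative (V' = Y)) as [e|n];
destruct (excluded_middle_informative (Y' = X)) as [e'|n']; simpl.
- destruct e, e'; simpl.
  destruct (excluded_middle_informative _) as [e|n]; [|now destruct n].
  destruct (excluded_middle_informative _) as [e'|n]; [|now destruct n].
  now rewrite !idhom_id, !comp_idl, compA.
- now destruct (excluded_middle_informative _).
- now destruct (excluded_middle_informative _).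
- reflexivity.
Qed.

Lemma ty_arr X Y (f : X ~> Y) : ty (arr f) X Y.
Proof. now exists f. Qed.

Lemma ty_id X : ty (ida X) X X.
Proof. apply ty_arr. Qed.

Lemma ty_eq a X X' Y Y' : ty a X Y -> X = X' -> Y = Y' -> ty a X' Y'.
Proof. now intros h <- <-. Qed.

(** The middle objects are related by an equation rather than by unification, since inferred
    endpoints agree only up to strictness. *)
Lemma ty_cmp a b X Y Y' Z : ty b X Y -> ty a Y' Z -> Y = Y' -> ty (a ∙ b) X Z.
Proof. intros [f ->] [g ->] <-; rewrite <- arr_comp; apply ty_arr. Qed.

Lemma cmp_idl a X Y Y' : ty a X Y -> Y = Y' -> ida Y' ∙ a = a.
Proof. intros [f ->] <-; unfold ida; now rewrite <- arr_comp, comp_idl. Qed.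

Lemma cmp_idr a X X' Y : ty a X Y -> X = X' -> a ∙ ida X' = a.
Proof. intros [f ->] <-; unfold ida; now rewrite <- arr_comp, comp_idr. Qed.

Lemma arr_idhom X Y (e : X = Y) : arr (idhom e) = ida X.
Proof. now destruct e. Qed.

Lemma arr_idhom_l X Y Z (f : X ~> Y) (e : Y = Z) : arr (idhom e ∘ f) = arr f.
Proof. destruct e; simpl; now rewrite comp_idl. Qed.

Lemma arr_idhom_r X Y Z (f : Y ~> Z) (e : X = Y) : arr (f ∘ idhom e) = arr f.
Proof. destruct e; simpl; now rewrite comp_idr. Qed.

Definition untype a X Y (h : ty a X Y) : X ~> Y :=
  proj1_sig (constructive_indefinite_description _ h).

Lemma untypeK a X Y (h : ty a X Y) : arr (untype h) = a.
Proof. unfold untype; now destruct (constructive_indefinite_description _ h). Qed.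

(** A rule for [a ∙ b] does not match inside [a ∙ (b ∙ t)]; this variant and the next ones rewrite
    in front of a tail. *)
Lemma cmp_tail2 a b r : a ∙ b = r -> forall t, a ∙ (b ∙ t) = r ∙ t.
Proof. intros h t; now rewrite cmpA, h. Qed.

Lemma cmp_tail3 a b c r : a ∙ (b ∙ c) = r -> forall t, a ∙ (b ∙ (c ∙ t)) = r ∙ t.
Proof. intros h t; now rewrite <- h, <- !cmpA. Qed.

Lemma cmp_tail4 a b c d r :
  a ∙ (b ∙ (c ∙ d)) = r -> forall t, a ∙ (b ∙ (c ∙ (d ∙ t))) = r ∙ t.
Proof. intros h t; now rewrite <- h, <- !cmpA. Qed.

End Arrows.

Section MonoidalArrows.
Variable C : StrictMonoidalCategory.
Implicit Types (X Y : C) (a b c : arrow C).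

Lemma arr_tensor X X' Y Y' (f : X ~> X') (g : Y ~> Y') : arr (f ⊠ g) = arr f ⊙ arr g.
Proof. reflexivity. Qed.

Lemma arr_lw X Y Y' (g : Y ~> Y') : arr (id X ⊠ g) = X ▹ arr g.
Proof. reflexivity. Qed.

Lemma arr_rw X X' Y (f : X ~> X') : arr (f ⊠ id Y) = arr f ◃ Y.
Proof. reflexivity. Qed.

Lemma tensA a b c : a ⊙ b ⊙ c = a ⊙ (b ⊙ c).
Proof.
destruct a as [[X X' f]|], b as [[Y Y' g]|], c as [[V V' h]|]; try reflexivity; simpl.
exact (arr_eq (tensor_homA f g h)).
Qed.

Lemma lw_unit a : 𝟙 ▹ a = a.
Proof. destruct a as [[X X' f]|]; [|reflexivity]; exact (arr_eq (tensor_hom1X f)). Qed.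

Lemma rw_unit a : a ◃ 𝟙 = a.
Proof. destruct a as [[X X' f]|]; [|reflexivity]; exact (arr_eq (tensor_homX1 f)). Qed.

Lemma lw_id X Y : X ▹ ida Y = ida (X ⊗ Y).
Proof. unfold lw, ida; now rewrite <- arr_tensor, tensor_id. Qed.

Lemma rw_id X Y : ida X ◃ Y = ida (X ⊗ Y).
Proof. exact (lw_id X Y). Qed.

Lemma lw_lw X Y a : X ▹ Y ▹ a = (X ⊗ Y) ▹ a.
Proof. unfold lw; rewrite <- tensA; f_equal; apply lw_id. Qed.

Lemma rw_rw X Y a : a ◃ X ◃ Y = a ◃ (X ⊗ Y).
Proof. unfold rw; rewrite tensA; f_equal; apply lw_id. Qed.

Lemma rw_lw X Y a : (X ▹ a) ◃ Y = X ▹ (a ◃ Y).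
Proof. apply tensA. Qed.

(** Typing matters: non-composable factors may have tensor products whose endpoints coincide, and
    then only the right side is defined. *)
Lemma tens_cmp a b c d X Y Z X' Y' Z' :
  ty b X Y -> ty a Y Z -> ty d X' Y' -> ty c Y' Z' ->
  (a ∙ b) ⊙ (c ∙ d) = (a ⊙ c) ∙ (b ⊙ d).
Proof.
intros [fb ->] [fa ->] [fd ->] [fc ->].
now rewrite <- !arr_comp, <- !arr_tensor, <- arr_comp, tensor_comp.
Qed.

Lemma ty_tens a b X X' Y Y' : ty a X X' -> ty b Y Y' -> ty (a ⊙ b) (X ⊗ Y) (X' ⊗ Y').
Proof. intros [f ->] [g ->]; apply ty_arr. Qed.

Lemma ty_lw a X Y Y' : ty a Y Y' -> ty (X ▹ a) (X ⊗ Y) (X ⊗ Y').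
Proof. apply ty_tens, ty_id. Qed.

Lemma ty_rw a X Y Y' : ty a Y Y' -> ty (a ◃ X) (Y ⊗ X) (Y' ⊗ X).
Proof. intros h; apply ty_tens; [exact h | apply ty_id]. Qed.

Lemma lw_cmp a b W X Y Y' Z : ty b X Y -> ty a Y' Z -> Y = Y' ->
  W ▹ (a ∙ b) = (W ▹ a) ∙ (W ▹ b).
Proof.
intros hb ha <-; unfold lw at 2 3.
rewrite <- (tens_cmp (ty_id W) (ty_id W) hb ha).
now rewrite (cmp_idl (ty_id W)).
Qed.

Lemma rw_cmp a b W X Y Y' Z : ty b X Y -> ty a Y' Z -> Y = Y' ->
  (a ∙ b) ◃ W = (a ◃ W) ∙ (b ◃ W).
Proof.
intros hb ha <-; unfold rw at 2 3.
rewrite <- (tens_cmp hb ha (ty_id W) (ty_id W)).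
now rewrite (cmp_idl (ty_id W)).
Qed.

Lemma tens_split a b X X' Y Y' : ty a X X' -> ty b Y Y' -> a ⊙ b = (a ◃ Y') ∙ (X ▹ b).
Proof.
intros ha hb; unfold lw, rw.
rewrite <- (tens_cmp (ty_id X) ha hb (ty_id Y')).
now rewrite (cmp_idr ha), (cmp_idl hb).
Qed.

Lemma slide a b X X' Y Y' : ty a X X' -> ty b Y Y' ->
  (a ◃ Y') ∙ (X ▹ b) = (X' ▹ b) ∙ (a ◃ Y).
Proof.
intros ha hb; rewrite <- (tens_split ha hb); unfold lw, rw.
rewrite <- (tens_cmp ha (ty_id X') (ty_id Y) hb).
now rewrite (cmp_idr hb), (cmp_idl ha).
Qed.

End MonoidalArrows.

Create HintDb ty discriminated.

Definition amap (C E : Category) (F : Functor C E) (a : arrow C) : arrow E :=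
  match a with Some f => arr (fmap F (mor f)) | None => None end.
Lemma ty_amap (C E : Category) (F : Functor C E) a X Y : ty a X Y -> ty (amap F a) (F X) (F Y).
Proof. intros [f ->]; apply ty_arr. Qed.

Lemma arr_fmap (C E : Category) (F : Functor C E) X Y (f : X ~> Y) : arr (fmap F f)
  = amap F (arr f).
Proof. reflexivity. Qed.

Lemma amap_id (C E : Category) (F : Functor C E) X : amap F (ida X) = ida (F X).
Proof. unfold ida; now rewrite <- arr_fmap, fmap_id. Qed.

Lemma amap_cmp (C E : Category) (F : Functor C E) a b X Y Y' W : ty b X Y -> ty a Y' W -> Y = Y' ->
  amap F (a ∙ b) = amap F a ∙ amap F b.
Proof. intros [f ->] [g ->] <-; now rewrite <- arr_comp, <- !arr_fmap, fmap_comp, arr_comp. Qed.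

(** * Typing and normalization of untyped composites *)

Ltac obj := rewrite ?tensorA, ?tensor1X, ?tensorX1; reflexivity.

(** Computes endpoints from the atoms upwards and leaves the strictness equations at the joints to
    [obj]. *)
Ltac ty_infer :=
  lazymatch goal with
  | |- ty (ida _) _ _ => apply ty_id
  | |- ty (cmp _ _) _ _ => eapply ty_cmp; [ty_infer | ty_infer | obj]
  | |- ty (lw _ _) _ _ => eapply ty_lw; ty_infer
  | |- ty (rw _ _) _ _ => eapply ty_rw; ty_infer
  | |- ty (amap _ _) _ _ => eapply ty_amap; ty_infer
  | |- ty (tens _ _) _ _ => eapply ty_tens; [ty_infer | ty_infer]
  | |- ty _ _ _ => first [solve [eauto 3 with ty] | apply ty_arr]
  end.
Ltac ty_solve := eapply ty_eq; [ty_infer | obj | obj].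

(* The normal form is a right-nested composite of layers X ▹ (f ◃ Y) with f atomic and
   X, Y right-nested tensor products. *)
Ltac nrm1 :=
  first
  [ rewrite lw_lw | rewrite rw_rw | rewrite rw_lw | rewrite lw_id | rewrite rw_id
  | rewrite lw_unit | rewrite rw_unit | rewrite amap_id
  | rewrite tensorA | rewrite tensor1X | rewrite tensorX1
  | rewrite <- cmpA
  | erewrite lw_cmp; [| ty_infer | ty_infer | obj]
  | erewrite rw_cmp; [| ty_infer | ty_infer | obj]
  | erewrite amap_cmp; [| ty_infer | ty_infer | obj]
  | erewrite cmp_idl; [| ty_infer | obj]
  | erewrite cmp_idr; [| ty_infer | obj]
  | erewrite tens_split; [| ty_infer | ty_infer] ].
Ltac nrm := repeat nrm1.
Ltac nrm_in H :=
  repeat first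
  [ rewrite lw_lw in H | rewrite rw_rw in H | rewrite rw_lw in H | rewrite lw_id in H
  | rewrite rw_id in H | rewrite lw_unit in H | rewrite rw_unit in H | rewrite amap_id in H
  | rewrite tensorA in H | rewrite tensor1X in H | rewrite tensorX1 in H
  | rewrite <- cmpA in H
  | erewrite lw_cmp in H; [| ty_infer | ty_infer | obj]
  | erewrite rw_cmp in H; [| ty_infer | ty_infer | obj]
  | erewrite amap_cmp in H; [| ty_infer | ty_infer | obj]
  | erewrite cmp_idl in H; [| ty_infer | obj]
  | erewrite cmp_idr in H; [| ty_infer | obj]
  | erewrite tens_split in H; [| ty_infer | ty_infer] ].

Ltac use_eq H :=
  first
  [ rewrite (cmp_tail4 H) | rewrite (cmp_tail3 H) | rewrite (cmp_tail2 H) | rewrite H ];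
  rewrite <- ?cmpA.

Ltac layer_rewrite H := nrm_in H; use_eq H; clear H; nrm.
(* [lrw E under A, B] rewrites with A ⊗ E ⊗ B, put in normal form, inside a normalized
   composite. *)
Tactic Notation "lrw" constr(E) :=
  let H := fresh in pose proof E as H; layer_rewrite H.
Tactic Notation "lrw" "<-" constr(E) :=
  let H := fresh in pose proof (eq_sym E) as H; layer_rewrite H.
Tactic Notation "lrw" constr(E) "under" uconstr(A) "," uconstr(B) :=
  let H := fresh in
  pose proof (f_equal (fun x => lw A (rw x B)) E) as H; cbv beta in H; layer_rewrite H.
Tactic Notation "lrw" "<-" constr(E) "under" uconstr(A) "," uconstr(B) :=
  let H := fresh in
  pose proof (f_equal (fun x => lw A (rw x B)) (eq_sym E)) as H; cbv beta in H;
  layer_rewrite H.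

Ltac untype :=
  unfold assoc, assocV, lunit, lunitV, runit, runitV;
  repeat first [ rewrite arr_idhom_l | rewrite arr_idhom_r | rewrite arr_comp
    | rewrite arr_fmap | rewrite amap_id | rewrite arr_lw | rewrite arr_rw | rewrite arr_tensor |
      rewrite arr_idhom
    | progress change (@arr ?C ?X ?X (id ?X)) with (@ida C X) ].
Ltac untype_in H :=
  unfold assoc, assocV, lunit, lunitV, runit, runitV in H;
  repeat first [ rewrite arr_idhom_l in H | rewrite arr_idhom_r in H | rewrite arr_comp in H
    | rewrite arr_fmap in H | rewrite amap_id in H | rewrite arr_lw in H | rewrite arr_rw in H |
      rewrite arr_tensor in H | rewrite arr_idhom in H ].

(** * Duals, mates and invertibility of families *)

Section Duals.
Variables (C : StrictMonoidalCategory) (A : Autonomous C).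
Definition Ev X := arr (ev A X).
Definition Coev X := arr (coev A X).
Definition Rev X := arr (rev A X).
Definition Rcoev X := arr (rcoev A X).

Lemma ty_Ev X : ty (Ev X) (ldual A X ⊗ X) 𝟙. Proof. apply ty_arr. Qed.

Lemma ty_Coev X : ty (Coev X) 𝟙 (X ⊗ ldual A X). Proof. apply ty_arr. Qed.

Lemma ty_Rev X : ty (Rev X) (X ⊗ rdual A X) 𝟙. Proof. apply ty_arr. Qed.

Lemma ty_Rcoev X : ty (Rcoev X) 𝟙 (rdual A X ⊗ X). Proof. apply ty_arr. Qed.

Lemma zz_l1 X : (X ▹ Ev X) ∙ (Coev X ◃ X) = ida X.
Proof.
pose proof (f_equal (fun f => arr f) (ldual_zigzag1 A X)) as h; untype_in h; exact h.
Qed.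

Lemma zz_l2 X : (Ev X ◃ ldual A X) ∙ (ldual A X ▹ Coev X) = ida (ldual A X).
Proof.
pose proof (f_equal (fun f => arr f) (ldual_zigzag2 A X)) as h; untype_in h; exact h.
Qed.

Lemma zz_r1 X : (Rev X ◃ X) ∙ (X ▹ Rcoev X) = ida X.
Proof.
pose proof (f_equal (fun f => arr f) (rdual_zigzag1 A X)) as h; untype_in h; exact h.
Qed.

Lemma zz_r2 X : (rdual A X ▹ Rev X) ∙ (Rcoev X ◃ rdual A X) = ida (rdual A X).
Proof.
pose proof (f_equal (fun f => arr f) (rdual_zigzag2 A X)) as h; untype_in h; exact h.
Qed.
End Duals.
Global Hint Resolve ty_Ev ty_Coev ty_Rev ty_Rcoev : ty.

Section DualHom.
Variables (C : StrictMonoidalCategory) (A : Autonomous C).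
Implicit Types X Y M N : C.
Notation Ev := (Ev A). Notation Coev := (Coev A).
Notation Rev := (Rev A). Notation Rcoev := (Rcoev A).
Notation L := (ldual A). Notation R := (rdual A).

(** The objects are explicit because an untyped arrow does not expose its endpoints. *)
Definition ldualmap X Y (a : arrow C) : arrow C :=
  (Ev Y ◃ L X) ∙ ((L Y ▹ (a ◃ L X)) ∙ (L Y ▹ Coev X)).
Definition rdualmap X Y (a : arrow C) : arrow C :=
  (R X ▹ Rev Y) ∙ ((R X ▹ (a ◃ R Y)) ∙ (Rcoev X ◃ R Y)).

Lemma arr_ldual_hom X Y (f : X ~> Y) : arr (ldual_hom A f) = ldualmap X Y (arr f).
Proof. unfold ldual_hom; untype; now rewrite <- !cmpA. Qed.

Lemma arr_rdual_hom X Y (f : X ~> Y) : arr (rdual_hom A f) = rdualmap X Y (arr f).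
Proof. unfold rdual_hom; untype; now rewrite <- !cmpA, rw_lw. Qed.

Lemma ty_ldualmap X Y a : ty a X Y -> ty (ldualmap X Y a) (L Y) (L X).
Proof. intros t; unfold ldualmap; ty_solve. Qed.

Lemma ty_rdualmap X Y a : ty a X Y -> ty (rdualmap X Y a) (R Y) (R X).
Proof. intros t; unfold rdualmap; ty_solve. Qed.

Hint Resolve ty_ldualmap ty_rdualmap : ty.

(** Interchange brings [Coev X] and [Ev X] together, and a zigzag cancels them. *)
Lemma Ev_ldualmap X Y a : ty a X Y -> Ev X ∙ (ldualmap X Y a ◃ X) = Ev Y ∙ (L Y ▹ a).
Proof.
intros t; unfold ldualmap; nrm.
lrw <- (slide (ty_Ev A Y) (ty_Ev A X)).
lrw <- (slide t (ty_Ev A X)) under (L Y), 𝟙.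
lrw (zz_l1 A X) under (L Y), 𝟙.
reflexivity.
Qed.

Lemma Coev_ldualmap X Y a : ty a X Y -> (Y ▹ ldualmap X Y a) ∙ Coev Y = (a ◃ L X) ∙ Coev X.
Proof.
intros t; unfold ldualmap; nrm.
lrw <- (slide (ty_Coev A Y) (ty_Coev A X)).
lrw <- (slide (ty_Coev A Y) t) under 𝟙, (L X).
lrw (zz_l1 A Y) under 𝟙, (L X).
reflexivity.
Qed.

Lemma Rev_rdualmap X Y a : ty a X Y -> Rev X ∙ (X ▹ rdualmap X Y a) = Rev Y ∙ (a ◃ R Y).
Proof.
intros t; unfold rdualmap; nrm.
lrw (slide (ty_Rev A X) (ty_Rev A Y)).
lrw (slide (ty_Rev A X) t) under 𝟙, (R Y).
lrw (zz_r1 A X) under 𝟙, (R Y).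
reflexivity.
Qed.

Lemma Rcoev_rdualmap X Y a : ty a X Y -> (rdualmap X Y a ◃ Y) ∙ Rcoev Y = (R X ▹ a) ∙ Rcoev X.
Proof.
intros t; unfold rdualmap; nrm.
lrw (slide (ty_Rcoev A X) (ty_Rcoev A Y)).
lrw (slide t (ty_Rcoev A Y)) under (R X), 𝟙.
lrw (zz_r1 A Y) under (R X), 𝟙.
reflexivity.
Qed.

Lemma ldualmap_cmp X Y W a b : ty a X Y -> ty b Y W ->
  ldualmap X W (b ∙ a) = ldualmap X Y a ∙ ldualmap Y W b.
Proof.
intros ta tb; unfold ldualmap at 1; nrm.
lrw <- (Coev_ldualmap ta) under (L W), 𝟙.
lrw (slide tb (ty_ldualmap ta)) under (L W), 𝟙.
lrw (slide (ty_Ev A W) (ty_ldualmap ta)).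
unfold ldualmap at 3; nrm; reflexivity.
Qed.

Lemma rdualmap_cmp X Y W a b : ty a X Y -> ty b Y W ->
  rdualmap X W (b ∙ a) = rdualmap X Y a ∙ rdualmap Y W b.
Proof.
intros ta tb; unfold rdualmap at 1; nrm.
lrw <- (Rcoev_rdualmap ta) under 𝟙, (R W).
lrw <- (slide (ty_rdualmap ta) (ty_rw (R W) tb)).
lrw <- (slide (ty_rdualmap ta) (ty_Rev A W)).
unfold rdualmap at 3; nrm; reflexivity.
Qed.

Lemma ldualmap_id X : ldualmap X X (ida X) = ida (L X).
Proof. unfold ldualmap; nrm; apply zz_l2. Qed.

Lemma rdualmap_id X : rdualmap X X (ida X) = ida (R X).
Proof. unfold rdualmap; nrm; apply zz_r2. Qed.
End DualHom.
Global Hint Resolve ty_ldualmap ty_rdualmap : ty.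

Section Mates.
Variables (C : StrictMonoidalCategory) (A : Autonomous C).
Implicit Types X Y M N : C.
Notation Ev := (Ev A). Notation Coev := (Coev A).
Notation Rev := (Rev A). Notation Rcoev := (Rcoev A).
Notation L := (ldual A). Notation R := (rdual A).

Section Inverses.
Variable (M : C).

(** A multiplicative family is inverted by its own component at a dual of [Y], with the strand [Y]
    bent around: the right dual for families [M ⊗ Y -> Y ⊗ M], the left dual for the opposite
    direction. *)
Definition right_inv (s : C -> arrow C) Y : arrow C :=
  (Rev Y ◃ (M ⊗ Y)) ∙ ((Y ▹ (s (R Y) ◃ Y)) ∙ ((Y ⊗ M) ▹ Rcoev Y)).
Definition left_inv (t : C -> arrow C) Y : arrow C :=
  ((Y ⊗ M) ▹ Ev Y) ∙ ((Y ▹ (t (L Y) ◃ Y)) ∙ (Coev Y ◃ (M ⊗ Y))).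

Section RightInverse.
Variable s : C -> arrow C.
Hypothesis ty_s : forall Y, ty (s Y) (M ⊗ Y) (Y ⊗ M).
Hypothesis s_nat : forall Y Y' g, ty g Y Y' -> s Y' ∙ (M ▹ g) = (g ◃ M) ∙ s Y.
Hypothesis s_tensor : forall Y Y', s (Y ⊗ Y') = (Y ▹ s Y') ∙ (s Y ◃ Y').
Hypothesis s_unit : s 𝟙 = ida M.
Hint Resolve ty_s : ty.

Lemma ty_right_inv Y : ty (right_inv s Y) (Y ⊗ M) (M ⊗ Y).
Proof. unfold right_inv; ty_solve. Qed.

(** The components at [Y] and [R Y] merge into the one at [Y ⊗ R Y]; naturality along [Rev Y]
    carries it to [s 𝟙], an identity, and a zigzag remains. *)
Lemma right_invK Y : right_inv s Y ∙ s Y = ida (M ⊗ Y).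
Proof.
unfold right_inv; nrm.
lrw <- (slide (ty_s Y) (ty_Rcoev A Y)).
lrw <- (s_tensor Y (R Y)) under 𝟙, Y.
lrw <- (s_nat (ty_Rev A Y)) under 𝟙, Y.
rewrite s_unit; nrm.
lrw (zz_r1 A Y) under M, 𝟙.
reflexivity.
Qed.

Lemma right_invKr Y : s Y ∙ right_inv s Y = ida (Y ⊗ M).
Proof.
unfold right_inv; nrm.
lrw <- (slide (ty_Rev A Y) (ty_s Y)).
lrw <- (s_tensor (R Y) Y) under Y, 𝟙.
lrw (s_nat (ty_Rcoev A Y)) under Y, 𝟙.
rewrite s_unit; nrm.
lrw (zz_r1 A Y) under 𝟙, M.
reflexivity.
Qed.
End RightInverse.

Section LeftInverse.
Variable t : C -> arrow C.
Hypothesis ty_t : forall Y, ty (t Y) (Y ⊗ M) (M ⊗ Y).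
Hypothesis t_nat : forall Y Y' g, ty g Y Y' -> t Y' ∙ (g ◃ M) = (M ▹ g) ∙ t Y.
Hypothesis t_tensor : forall Y Y', t (Y ⊗ Y') = (t Y ◃ Y') ∙ (Y ▹ t Y').
Hypothesis t_unit : t 𝟙 = ida M.
Hint Resolve ty_t : ty.

Lemma ty_left_inv Y : ty (left_inv t Y) (M ⊗ Y) (Y ⊗ M).
Proof. unfold left_inv; ty_solve. Qed.

Lemma left_invK Y : left_inv t Y ∙ t Y = ida (Y ⊗ M).
Proof.
unfold left_inv; nrm.
lrw (slide (ty_Coev A Y) (ty_t Y)).
lrw <- (t_tensor (L Y) Y) under Y, 𝟙.
lrw <- (t_nat (ty_Ev A Y)) under Y, 𝟙.
rewrite t_unit; nrm.
lrw (zz_l1 A Y) under 𝟙, M.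
reflexivity.
Qed.

Lemma left_invKr Y : t Y ∙ left_inv t Y = ida (M ⊗ Y).
Proof.
unfold left_inv; nrm.
lrw (slide (ty_t Y) (ty_Ev A Y)).
lrw <- (t_tensor Y (L Y)) under 𝟙, Y.
lrw (t_nat (ty_Coev A Y)) under 𝟙, Y.
rewrite t_unit; nrm.
lrw (zz_l1 A Y) under M, 𝟙.
reflexivity.
Qed.
End LeftInverse.
End Inverses.

(** Transposition reverses the direction of the crossing: a left mate leads from [Y ⊗ M -> M ⊗ Y] to
    [L M ⊗ Y -> Y ⊗ L M], a right mate from [M ⊗ Y -> Y ⊗ M] to [Y ⊗ R M -> R M ⊗ Y]. *)
Definition left_mate M (t : C -> arrow C) Y : arrow C :=
  (Ev M ◃ (Y ⊗ L M)) ∙ ((L M ▹ (t Y ◃ L M)) ∙ ((L M ⊗ Y) ▹ Coev M)).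
Definition right_mate M (s : C -> arrow C) Y : arrow C :=
  ((R M ⊗ Y) ▹ Rev M) ∙ ((R M ▹ (s Y ◃ R M)) ∙ (Rcoev M ◃ (Y ⊗ R M))).

Section LeftMate.
Variables (M : C) (t : C -> arrow C).
Hypothesis ty_t : forall Y, ty (t Y) (Y ⊗ M) (M ⊗ Y).
Hint Resolve ty_t : ty.

Lemma ty_left_mate Y : ty (left_mate M t Y) (L M ⊗ Y) (Y ⊗ L M).
Proof. unfold left_mate; ty_solve. Qed.

Lemma left_mate_ev Y : (Y ▹ Ev M) ∙ (left_mate M t Y ◃ M) = (Ev M ◃ Y) ∙ (L M ▹ t Y).
Proof.
unfold left_mate; nrm.
lrw <- (slide (ty_Ev A M) (ty_lw Y (ty_Ev A M))).
lrw <- (slide (ty_t Y) (ty_Ev A M)) under (L M), 𝟙.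
lrw (zz_l1 A M) under (L M ⊗ Y), 𝟙.
reflexivity.
Qed.

Lemma left_mate_coev Y : (M ▹ left_mate M t Y) ∙ (Coev M ◃ Y) = (t Y ◃ L M) ∙ (Y ▹ Coev M).
Proof.
unfold left_mate; nrm.
lrw <- (slide (ty_Coev A M) (ty_lw Y (ty_Coev A M))).
lrw <- (slide (ty_Coev A M) (ty_t Y)) under 𝟙, (L M).
lrw (zz_l1 A M) under 𝟙, (Y ⊗ L M).
reflexivity.
Qed.

Lemma left_mate_nat Y Y' g : ty g Y Y' -> t Y' ∙ (g ◃ M) = (M ▹ g) ∙ t Y ->
  left_mate M t Y' ∙ (L M ▹ g) = (g ◃ L M) ∙ left_mate M t Y.
Proof.
intros tg n; unfold left_mate; nrm.
lrw <- (slide (ty_lw (L M) tg) (ty_Coev A M)).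
lrw n under (L M), (L M).
lrw (slide (ty_Ev A M) (ty_rw (L M) tg)).
reflexivity.
Qed.
End LeftMate.

(** At the coevaluation the dual of [f] becomes [f]; hypothesis [e] moves it across the family, and
    evaluation turns it back into its dual. *)
Lemma left_mate_map M N t u f Y :
  (forall Y, ty (t Y) (Y ⊗ M) (M ⊗ Y)) -> (forall Y, ty (u Y) (Y ⊗ N) (N ⊗ Y)) ->
  ty f M N -> u Y ∙ (Y ▹ f) = (f ◃ Y) ∙ t Y ->
  (Y ▹ ldualmap A M N f) ∙ left_mate N u Y = left_mate M t Y ∙ (ldualmap A M N f ◃ Y).
Proof.
intros tt tu tf e; unfold left_mate; nrm.
lrw <- (slide (ty_Ev A N) (ty_lw Y (ty_ldualmap A tf))).
lrw <- (slide (tu Y) (ty_ldualmap A tf)) under (L N), 𝟙.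
lrw (Coev_ldualmap A tf) under (L N ⊗ Y), 𝟙.
lrw e under (L N), (L M).
lrw <- (slide (ty_ldualmap A tf) (ty_lw Y (ty_Coev A M))).
lrw <- (slide (ty_ldualmap A tf) (tt Y)) under 𝟙, (L M).
lrw (Ev_ldualmap A tf) under 𝟙, (Y ⊗ L M).
reflexivity.
Qed.

Section RightMate.
Variables (M : C) (s : C -> arrow C).
Hypothesis ty_s : forall Y, ty (s Y) (M ⊗ Y) (Y ⊗ M).
Hint Resolve ty_s : ty.

Lemma ty_right_mate Y : ty (right_mate M s Y) (Y ⊗ R M) (R M ⊗ Y).
Proof. unfold right_mate; ty_solve. Qed.

Hint Resolve ty_right_mate : ty.

Lemma right_mate_ev Y : (Rev M ◃ Y) ∙ (M ▹ right_mate M s Y) = (Y ▹ Rev M) ∙ (s Y ◃ R M).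
Proof.
unfold right_mate; nrm.
lrw (slide (ty_Rev A M) (ty_lw Y (ty_Rev A M))).
lrw (slide (ty_Rev A M) (ty_s Y)) under 𝟙, (R M).
lrw (zz_r1 A M) under 𝟙, (Y ⊗ R M).
reflexivity.
Qed.

Lemma right_mate_coev Y : (right_mate M s Y ◃ M) ∙ (Y ▹ Rcoev M) = (R M ▹ s Y) ∙ (Rcoev M ◃ Y).
Proof.
unfold right_mate; nrm.
lrw (slide (ty_Rcoev A M) (ty_lw Y (ty_Rcoev A M))).
lrw (slide (ty_s Y) (ty_Rcoev A M)) under (R M), 𝟙.
lrw (zz_r1 A M) under (R M ⊗ Y), 𝟙.
reflexivity.
Qed.

Lemma right_mate_nat Y Y' g : ty g Y Y' -> s Y' ∙ (M ▹ g) = (g ◃ M) ∙ s Y ->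
  right_mate M s Y' ∙ (g ◃ R M) = (R M ▹ g) ∙ right_mate M s Y.
Proof.
intros tg n; unfold right_mate; nrm.
lrw (slide (ty_Rcoev A M) (ty_rw (R M) tg)).
lrw n under (R M), (R M).
lrw <- (slide tg (ty_Rev A M)) under (R M), 𝟙.
reflexivity.
Qed.

Lemma right_mate_unit : s 𝟙 = ida M -> right_mate M s 𝟙 = ida (R M).
Proof.
intros e; unfold right_mate; rewrite e; nrm.
lrw (zz_r2 A M).
reflexivity.
Qed.

(** Makes the mate a multiplicative family, so that [left_inv] inverts it. *)
Lemma right_mate_tensor Y Y' : s (Y ⊗ Y') = (Y ▹ s Y') ∙ (s Y ◃ Y') ->
  right_mate M s (Y ⊗ Y') = (right_mate M s Y ◃ Y') ∙ (Y ▹ right_mate M s Y').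
Proof.
intros e; unfold right_mate at 1; rewrite e; nrm.
lrw <- (right_mate_coev Y) under 𝟙, (Y' ⊗ R M).
lrw <- (slide (ty_right_mate Y) (ty_rw (R M) (ty_s Y'))).
lrw <- (slide (ty_right_mate Y) (ty_lw Y' (ty_Rev A M))).
unfold right_mate at 3; nrm. reflexivity.
Qed.
End RightMate.

Lemma right_mate_map M N s u f Y :
  (forall Y, ty (s Y) (M ⊗ Y) (Y ⊗ M)) -> (forall Y, ty (u Y) (N ⊗ Y) (Y ⊗ N)) ->
  ty f M N -> u Y ∙ (f ◃ Y) = (Y ▹ f) ∙ s Y ->
  (rdualmap A M N f ◃ Y) ∙ right_mate N u Y = right_mate M s Y ∙ (Y ▹ rdualmap A M N f).
Proof.
intros ts tu tf e; unfold right_mate; nrm.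
lrw (slide (ty_rdualmap A tf) (ty_lw Y (ty_Rev A N))).
lrw (slide (ty_rdualmap A tf) (tu Y)) under 𝟙, (R N).
lrw (Rcoev_rdualmap A tf) under 𝟙, (Y ⊗ R N).
lrw e under (R M), (R N).
lrw (slide (ty_Rcoev A M) (ty_lw Y (ty_rdualmap A tf))).
lrw (slide (ts Y) (ty_rdualmap A tf)) under (R M), 𝟙.
lrw (Rev_rdualmap A tf) under (R M ⊗ Y), 𝟙.
reflexivity.
Qed.
End Mates.

(** * The bimonad structure of the centralizer *)

Section CentralizerBimonad.
Variables (C : StrictMonoidalCategory) (A : Autonomous C)
    (Z : Functor C C) (d : forall X Y : C, X ⊗ Y ~> Y ⊗ Z X)
    (dZ : is_centralizer d).
Definition univ X Y := arr (d X Y).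
Local Notation D := univ.

Lemma ty_univ X Y : ty (D X Y) (X ⊗ Y) (Y ⊗ Z X). Proof. apply ty_arr. Qed.

Hint Resolve ty_univ : ty.

Lemma univ_natural_l X X' Y f : ty f X X' -> D X' Y ∙ (f ◃ Y) = (Y ▹ amap Z f) ∙ D X Y.
Proof.
intros [g ->]; unfold univ.
now rewrite <- arr_fmap, <- arr_lw, <- arr_rw, <- !arr_comp, (centralizer_natural dZ).
Qed.

Lemma univ_natural_r X Y Y' g : ty g Y Y' -> D X Y' ∙ (X ▹ g) = (g ◃ Z X) ∙ D X Y.
Proof.
intros [f ->]; unfold univ.
now rewrite <- arr_lw, <- arr_rw, <- !arr_comp, (centralizer_natural dZ), fmap_id.
Qed.

Lemma univ_exists X W xi : (forall Y, ty (xi Y) (X ⊗ Y) (Y ⊗ W)) ->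
  (forall Y Y' g, ty g Y Y' -> xi Y' ∙ (X ▹ g) = (g ◃ W) ∙ xi Y) ->
  exists r, ty r (Z X) W /\ forall Y, (Y ▹ r) ∙ D X Y = xi Y.
Proof.
intros h n.
destruct (@centralizer_universal _ _ _ dZ X W (fun Y => untype (h Y))) as [r [hr _]].
- intros; apply arr_inj; untype; rewrite !untypeK; apply n, ty_arr.
- exists (arr r); split; [apply ty_arr|]; intros Y.
  unfold univ; now rewrite <- arr_lw, <- arr_comp, <- hr, untypeK.
Qed.

Lemma univ_unique X W r r' : ty r (Z X) W -> ty r' (Z X) W ->
  (forall Y, (Y ▹ r) ∙ D X Y = (Y ▹ r') ∙ D X Y) -> r = r'.
Proof.
intros [f ->] [f' ->] h; f_equal.
destruct (@centralizer_universal _ _ _ dZ X W (fun Y => (id Y ⊠ f) ∘ d X Y)) as [r [_ u]].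
- intros; rewrite <- compA, (centralizer_natural dZ), fmap_id, !compA, <- !tensor_comp.
  now rewrite !comp_idl, !comp_idr.
- transitivity r; [symmetry|]; apply u; [reflexivity|].
  intros Y; apply arr_inj; untype; apply h.
Qed.

(** Coevaluation moves the spectator [V] to the target as its left dual, where the plain universal
    property applies; evaluation moves it back. *)
Lemma univ_exists_param V U X xi : (forall Y, ty (xi Y) (X ⊗ (Y ⊗ V)) (Y ⊗ U)) ->
  (forall Y Y' g, ty g Y Y' -> xi Y' ∙ (X ▹ (g ◃ V)) = (g ◃ U) ∙ xi Y) ->
  exists r, ty r (Z X ⊗ V) U /\ forall Y, (Y ▹ r) ∙ (D X Y ◃ V) = xi Y.
Proof.
intros h n; pose (L := ldual A V).
destruct (@univ_exists X (U ⊗ L) (fun Y => (xi Y ◃ L) ∙ ((X ⊗ Y) ▹ Coev A V))) as [r [tr hr]].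
- intros Y; ty_solve.
- intros Y Y' g tg; cbv beta; nrm.
  lrw <- (slide tg (ty_Coev A V)) under X, 𝟙.
  lrw (n _ _ _ tg) under 𝟙, L; reflexivity.
- exists ((U ▹ Ev A V) ∙ (r ◃ V)); split; [ty_solve|]; intros Y; nrm.
  lrw (hr Y) under 𝟙, V.
  lrw <- (slide (h Y) (ty_Ev A V)).
  lrw (zz_l1 A V) under (X⊗Y), 𝟙.
  reflexivity.
Qed.

Lemma univ_unique_param V U X r r' : ty r (Z X ⊗ V) U -> ty r' (Z X ⊗ V) U ->
  (forall Y, (Y ▹ r) ∙ (D X Y ◃ V) = (Y ▹ r') ∙ (D X Y ◃ V)) -> r = r'.
Proof.
intros t t' h; pose (L := ldual A V).
assert (k : (r ◃ L) ∙ (Z X ▹ Coev A V) = (r' ◃ L) ∙ (Z X ▹ Coev A V)).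
{ apply (@univ_unique X (U ⊗ L)); try ty_solve; intros Y; nrm.
  lrw <- (slide (ty_univ X Y) (ty_Coev A V)).
  lrw (h Y) under 𝟙, L; reflexivity. }
(* By a zigzag an arrow is recovered from its version with [V] bent away, so equality of the bent
   versions suffices. *)
assert (j : forall s, ty s (Z X ⊗ V) U -> s = (U ▹ Ev A V) ∙ (((s ◃ L) ∙ (Z X ▹ Coev A V)) ◃ V)).
{ intros s ts; nrm.
  lrw <- (slide ts (ty_Ev A V)).
  lrw (zz_l1 A V) under (Z X), 𝟙; reflexivity. }
now rewrite (j _ t), (j _ t'), k.
Qed.

(** After the outer [Z] is tested, the remaining arrows out of [Z X ⊗ Y2] are tested with [Y2] as
    spectator. *)
Lemma univ2_unique X W r r' : ty r (Z (Z X)) W -> ty r' (Z (Z X)) W ->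
  (forall Y1 Y2, ((Y1 ⊗ Y2) ▹ r) ∙ ((Y1 ▹ D (Z X) Y2) ∙ (D X Y1 ◃ Y2))
    = ((Y1 ⊗ Y2) ▹ r') ∙ ((Y1 ▹ D (Z X) Y2) ∙ (D X Y1 ◃ Y2))) -> r = r'.
Proof.
intros t t' h; apply (univ_unique t t'); intros Y2.
apply (@univ_unique_param Y2 (Y2 ⊗ W) X); try ty_solve; intros Y1; nrm; apply h.
Qed.

Lemma univ3_unique X W r r' : ty r (Z (Z (Z X))) W -> ty r' (Z (Z (Z X))) W ->
  (forall Y1 Y2 Y3,
    ((Y1 ⊗ (Y2 ⊗ Y3)) ▹ r) ∙ (((Y1 ⊗ Y2) ▹ D (Z (Z X)) Y3)
      ∙ ((Y1 ▹ (D (Z X) Y2 ◃ Y3)) ∙ (D X Y1 ◃ (Y2 ⊗ Y3))))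
    = ((Y1 ⊗ (Y2 ⊗ Y3)) ▹ r') ∙ (((Y1 ⊗ Y2) ▹ D (Z (Z X)) Y3)
      ∙ ((Y1 ▹ (D (Z X) Y2 ◃ Y3)) ∙ (D X Y1 ◃ (Y2 ⊗ Y3))))) -> r = r'.
Proof.
intros t t' h; apply (univ2_unique t t'); intros Y2 Y3.
apply (@univ_unique_param (Y2 ⊗ Y3) (Y2 ⊗ Y3 ⊗ W) X); try ty_solve; intros Y1; nrm; apply h.
Qed.

(** With [Y2] as spectator the family in [Y1] factors through [Z X ⊗ Y2]; the factors form a family
    in [Y2], which factors through [Z (Z X)]. *)
Lemma univ2_exists X W xi : (forall Y1 Y2, ty (xi Y1 Y2) (X ⊗ (Y1 ⊗ Y2)) (Y1 ⊗ (Y2 ⊗ W))) ->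
  (forall Y1 Y1' Y2 g, ty g Y1 Y1' ->
    xi Y1' Y2 ∙ (X ▹ (g ◃ Y2)) = (g ◃ (Y2 ⊗ W)) ∙ xi Y1 Y2) ->
  (forall Y1 Y2 Y2' g, ty g Y2 Y2' ->
    xi Y1 Y2' ∙ ((X ⊗ Y1) ▹ g) = (Y1 ▹ (g ◃ W)) ∙ xi Y1 Y2) ->
  exists r, ty r (Z (Z X)) W
    /\ forall Y1 Y2, ((Y1 ⊗ Y2) ▹ r) ∙ ((Y1 ▹ D (Z X) Y2) ∙ (D X Y1 ◃ Y2)) = xi Y1 Y2.
Proof.
intros h n1 n2.
assert (H : forall Y2, exists r, ty r (Z X ⊗ Y2) (Y2 ⊗ W)
    /\ forall Y1, (Y1 ▹ r) ∙ (D X Y1 ◃ Y2) = xi Y1 Y2).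
{ intros Y2; apply (@univ_exists_param Y2 (Y2 ⊗ W) X (fun Y1 => xi Y1 Y2)); [auto|].
  intros Y Y' g tg; apply n1; exact tg. }
(* The factors are chosen separately for each [Y2]; their naturality will follow from uniqueness. *)
destruct (choice _ H) as [phi hphi].
assert (tphi : forall Y, ty (phi Y) (Z X ⊗ Y) (Y ⊗ W)) by apply hphi.
assert (ephi : forall Y1 Y2, (Y1 ▹ phi Y2) ∙ (D X Y1 ◃ Y2) = xi Y1 Y2) by (intros; apply hphi).
destruct (@univ_exists (Z X) W phi tphi) as [r [tr hr]].
- intros Y Y' g tg; apply (@univ_unique_param Y (Y' ⊗ W) X); try ty_solve; intros Y1; nrm.
  lrw <- (slide (ty_univ X Y1) tg).
  lrw (ephi Y1 Y'). rewrite (n2 _ _ _ _ tg).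
  now rewrite <- ephi.
- exists r; split; [exact tr|]; intros Y1 Y2.
  rewrite <- (ephi Y1 Y2), <- (hr Y2). nrm.
  reflexivity.
Qed.

(* The four families characterizing the structure of Z are abstracted over, because the
   typed bimonad can only be formed once its laws are known. *)
Section Laws.
Variables (Mu Eta : C -> arrow C) (Cm2 : C -> C -> arrow C) (Cm0 : arrow C).
Hypothesis ty_Mu : forall X, ty (Mu X) (Z (Z X)) (Z X).
Hypothesis ty_Eta : forall X, ty (Eta X) X (Z X).
Hypothesis ty_Cm2 : forall X Y, ty (Cm2 X Y) (Z (X ⊗ Y)) (Z X ⊗ Z Y).
Hypothesis ty_Cm0 : ty Cm0 (Z 𝟙) 𝟙.
Hypothesis Mu_D : forall X Y1 Y2,
  ((Y1 ⊗ Y2) ▹ Mu X) ∙ ((Y1 ▹ D (Z X) Y2) ∙ (D X Y1 ◃ Y2)) = D X (Y1 ⊗ Y2).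
Hypothesis Eta_D : forall X, Eta X = D X 𝟙.
Hypothesis Cm2_D : forall X1 X2 Y,
  (Y ▹ Cm2 X1 X2) ∙ D (X1 ⊗ X2) Y = (D X1 Y ◃ Z X2) ∙ (X1 ▹ D X2 Y).
Hypothesis Cm0_D : forall Y, (Y ▹ Cm0) ∙ D 𝟙 Y = ida Y.
Hint Resolve ty_Mu ty_Eta ty_Cm2 ty_Cm0 : ty.

Lemma mu_law_natural X X' f : ty f X X' -> Mu X' ∙ amap Z (amap Z f) = amap Z f ∙ Mu X.
Proof.
intros tf; apply (@univ2_unique X (Z X')); try ty_solve; intros Y1 Y2; nrm.
lrw <- (univ_natural_l Y2 (ty_amap Z tf)) under Y1, 𝟙.
lrw <- (univ_natural_l Y1 tf) under 𝟙, Y2.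
lrw (Mu_D X' Y1 Y2).
lrw (Mu_D X Y1 Y2).
exact (univ_natural_l _ tf).
Qed.

(** Tested on three variables, both sides give [D X (Y1 ⊗ (Y2 ⊗ Y3))]. *)
Lemma mu_law_assoc X : Mu X ∙ amap Z (Mu X) = Mu X ∙ Mu (Z X).
Proof.
apply (@univ3_unique X (Z X)); try ty_solve; intros Y1 Y2 Y3; nrm.
lrw <- (univ_natural_l Y3 (ty_Mu X)) under (Y1 ⊗ Y2), 𝟙.
lrw (Mu_D X Y1 Y2) under 𝟙, Y3.
lrw (Mu_D X (Y1 ⊗ Y2) Y3).
lrw (Mu_D (Z X) Y2 Y3) under Y1, 𝟙.
lrw (Mu_D X Y1 (Y2 ⊗ Y3)).
reflexivity.
Qed.

Lemma mu_law_etal X : Mu X ∙ Eta (Z X) = ida (Z X).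
Proof.
rewrite Eta_D; apply (@univ_unique X (Z X)); try ty_solve; intros Y; nrm.
lrw (Mu_D X Y 𝟙).
reflexivity.
Qed.

Lemma mu_law_etar X : Mu X ∙ amap Z (Eta X) = ida (Z X).
Proof.
rewrite Eta_D; apply (@univ_unique X (Z X)); try ty_solve; intros Y; nrm.
(* By strictness [D X 𝟙] also has type [X -> Z X], the one to which naturality in the first argument
   applies. *)
assert (t : ty (D X 𝟙) X (Z X)) by ty_solve.
lrw <- (univ_natural_l Y t).
lrw (Mu_D X 𝟙 Y).
reflexivity.
Qed.

Lemma eta_law_natural X X' f : ty f X X' -> Eta X' ∙ f = amap Z f ∙ Eta X.
Proof.
intros tf; rewrite !Eta_D; pose proof (univ_natural_l 𝟙 tf) as h; nrm_in h; exact h.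
Qed.

Lemma cm2_law_natural X X' Y Y' f g : ty f X X' -> ty g Y Y' ->
  Cm2 X' Y' ∙ amap Z (f ⊙ g) = (amap Z f ⊙ amap Z g) ∙ Cm2 X Y.
Proof.
intros tf tg; apply (@univ_unique (X ⊗ Y) (Z X' ⊗ Z Y')); try ty_solve; intros V; nrm.
lrw (Cm2_D X Y V).
lrw <- (univ_natural_l V (ty_tens tf tg)).
lrw (Cm2_D X' Y' V).
lrw <- (slide (ty_univ X V) (ty_amap Z tg)).
lrw <- (univ_natural_l V tf) under 𝟙, (Z Y').
lrw <- (univ_natural_l V tg) under X, 𝟙.
lrw <- (slide tf (ty_univ Y' V)).
reflexivity.
Qed.

Lemma cm2_law_coassoc X Y V : (Cm2 X Y ◃ Z V) ∙ Cm2 (X ⊗ Y) V = (Z X ▹ Cm2 Y V) ∙ Cm2 X (Y ⊗ V).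
Proof.
apply (@univ_unique (X ⊗ (Y ⊗ V)) (Z X ⊗ (Z Y ⊗ Z V))); try ty_solve; intros W; nrm.
lrw (Cm2_D X (Y ⊗ V) W).
lrw (Cm2_D (X ⊗ Y) V W).
lrw (Cm2_D X Y W) under 𝟙, (Z V).
lrw <- (slide (ty_univ X W) (ty_Cm2 Y V)).
lrw (Cm2_D Y V W) under X, 𝟙.
reflexivity.
Qed.

Lemma cm2_law_counitl X : (Cm0 ◃ Z X) ∙ Cm2 𝟙 X = ida (Z X).
Proof.
apply (@univ_unique X (Z X)); try ty_solve; intros W; nrm.
lrw (Cm2_D 𝟙 X W).
lrw (Cm0_D W) under 𝟙, (Z X).
reflexivity.
Qed.

Lemma cm2_law_counitr X : (Z X ▹ Cm0) ∙ Cm2 X 𝟙 = ida (Z X).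
Proof.
apply (@univ_unique X (Z X)); try ty_solve; intros W; nrm.
lrw (Cm2_D X 𝟙 W).
lrw <- (slide (ty_univ X W) ty_Cm0).
lrw (Cm0_D W) under X, 𝟙.
reflexivity.
Qed.

(** Both sides carry [X ⊗ Y] past [Y1 ⊗ Y2]; interchange regroups the four crossings into those of
    [Y] and those of [X]. *)
Lemma mu_law_cm2 X Y : Cm2 X Y ∙ Mu (X ⊗ Y)
  = (Mu X ⊙ Mu Y) ∙ (Cm2 (Z X) (Z Y) ∙ amap Z (Cm2 X Y)).
Proof.
apply (@univ2_unique (X ⊗ Y) (Z X ⊗ Z Y)); try ty_solve; intros Y1 Y2; nrm.
lrw (Mu_D (X ⊗ Y) Y1 Y2).
lrw (Cm2_D X Y (Y1 ⊗ Y2)).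
lrw <- (univ_natural_l Y2 (ty_Cm2 X Y)) under Y1, 𝟙.
lrw (Cm2_D (Z X) (Z Y) Y2) under Y1, 𝟙.
lrw (Cm2_D X Y Y1) under 𝟙, Y2.
lrw <- (slide (ty_univ X Y1) (ty_univ (Z Y) Y2)).
lrw <- (slide (ty_univ (Z X) Y2) (ty_Mu Y)) under Y1, 𝟙.
lrw <- (slide (ty_univ X Y1) (ty_lw Y2 (ty_Mu Y))).
lrw (Mu_D Y Y1 Y2) under X, 𝟙.
lrw (Mu_D X Y1 Y2) under 𝟙, (Z Y).
reflexivity.
Qed.

Lemma mu_law_cm0 : Cm0 ∙ Mu 𝟙 = Cm0 ∙ amap Z Cm0.
Proof.
apply (@univ2_unique 𝟙 𝟙); try ty_solve; intros Y1 Y2; nrm.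
lrw (Mu_D 𝟙 Y1 Y2).
lrw (Cm0_D (Y1 ⊗ Y2)).
lrw <- (univ_natural_l Y2 ty_Cm0) under Y1, 𝟙.
lrw (Cm0_D Y1) under 𝟙, Y2.
lrw (Cm0_D Y2) under Y1, 𝟙.
reflexivity.
Qed.

Lemma eta_law_cm2 X Y : Cm2 X Y ∙ Eta (X ⊗ Y) = (Eta X ⊙ Eta Y) ∙ ida (X ⊗ Y).
Proof.
rewrite (cmp_idr (ty_tens (ty_Eta X) (ty_Eta Y)) eq_refl).
rewrite (tens_split (ty_Eta X) (ty_Eta Y)), !Eta_D.
pose proof (Cm2_D X Y 𝟙) as h; nrm_in h; exact h.
Qed.

Lemma eta_law_cm0 : Cm0 ∙ Eta 𝟙 = ida 𝟙.
Proof. rewrite Eta_D; pose proof (Cm0_D 𝟙) as h; nrm_in h; exact h. Qed.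
End Laws.

(** Stated for a single morphism, so that it serves both to construct the structure and to compare
    two given bimonads. *)
Definition bimonad_mu_spec (X : C) (m : Z (Z X) ~> Z X) : Prop := forall Y1 Y2,
  ((Y1 ⊗ Y2) ▹ arr m) ∙ ((Y1 ▹ D (Z X) Y2) ∙ (D X Y1 ◃ Y2)) = D X (Y1 ⊗ Y2).
Definition bimonad_cm2_spec (X1 X2 : C) (f : Z (X1 ⊗ X2) ~> Z X1 ⊗ Z X2) : Prop :=
  forall Y, (Y ▹ arr f) ∙ D (X1 ⊗ X2) Y = (D X1 Y ◃ Z X2) ∙ (X1 ▹ D X2 Y).
Definition bimonad_cm0_spec (f : Z 𝟙 ~> 𝟙) : Prop :=
  forall Y, (Y ▹ arr f) ∙ D 𝟙 Y = ida Y.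

Lemma bimonad_mu_ex X : exists m, @bimonad_mu_spec X m.
Proof.
destruct (@univ2_exists X (Z X) (fun Y1 Y2 => D X (Y1 ⊗ Y2))) as [r [[m ->] h]].
- intros; ty_solve.
- intros Y1 Y1' Y2 g tg; cbv beta; pose proof (univ_natural_r X (ty_rw Y2 tg)) as h; nrm_in h;
    exact h.
- intros Y1 Y2 Y2' g tg; cbv beta; pose proof (univ_natural_r X (ty_lw Y1 tg)) as h; nrm_in h;
    exact h.
- now exists m.
Qed.

Lemma bimonad_cm2_ex X1 X2 : exists f, @bimonad_cm2_spec X1 X2 f.
Proof.
destruct (@univ_exists (X1 ⊗ X2) (Z X1 ⊗ Z X2)
  (fun Y => (D X1 Y ◃ Z X2) ∙ (X1 ▹ D X2 Y))) as [r [[m ->] h]].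
- intros; ty_solve.
- intros Y Y' g tg; cbv beta; nrm.
  lrw (univ_natural_r X2 tg) under X1, 𝟙. lrw (univ_natural_r X1 tg) under 𝟙, (Z X2).
  reflexivity.
- now exists m.
Qed.

Lemma bimonad_cm0_ex : exists f, bimonad_cm0_spec f.
Proof.
destruct (@univ_exists 𝟙 𝟙 (fun Y => ida Y)) as [r [[m ->] h]].
- intros; ty_solve.
- intros Y Y' g tg; cbv beta; nrm. reflexivity.
- now exists m.
Qed.

Section OfBimonad.
Variables (B : Bimonad Z) (hB : is_centralizer_bimonad d B).

Lemma bimonad_mu_D X : @bimonad_mu_spec X (mu B X).
Proof.
intros Y1 Y2; pose proof (f_equal (fun f => arr f) (centralizer_mu hB X Y1 Y2)) as h.
untype_in h; rewrite <- !cmpA in h; exact h.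
Qed.

Lemma bimonad_eta_D X : arr (eta B X) = D X 𝟙.
Proof. rewrite (centralizer_eta hB); untype; reflexivity. Qed.

Lemma bimonad_cm2_D X1 X2 : bimonad_cm2_spec (cm2 (bm_comonoidal B) X1 X2).
Proof.
intros Y; pose proof (f_equal (fun f => arr f) (centralizer_cm2 hB X1 X2 Y)) as h.
untype_in h; exact h.
Qed.

Lemma bimonad_cm0_D : bimonad_cm0_spec (cm0 (bm_comonoidal B)).
Proof.
intros Y; pose proof (f_equal (fun f => arr f) (centralizer_cm0 hB Y)) as h.
untype_in h; exact (eq_trans h (f_equal (@ida C) (tensor1X Y))).
Qed.
End OfBimonad.

Lemma bimonad_mu_uniq X m m' : @bimonad_mu_spec X m -> @bimonad_mu_spec X m' -> m = m'.
Proof.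
intros h h'; apply arr_inj; apply (@univ2_unique X (Z X)); try apply ty_arr.
intros; now rewrite h, h'.
Qed.

Lemma bimonad_cm2_uniq X1 X2 m m' : @bimonad_cm2_spec X1 X2 m -> bimonad_cm2_spec m' -> m = m'.
Proof.
intros h h'; apply arr_inj; apply (@univ_unique (X1 ⊗ X2) (Z X1 ⊗ Z X2)); try apply ty_arr.
intros; now rewrite h, h'.
Qed.

Lemma bimonad_cm0_uniq m m' : bimonad_cm0_spec m -> bimonad_cm0_spec m' -> m = m'.
Proof.
intros h h'; apply arr_inj; apply (@univ_unique 𝟙 𝟙); try apply ty_arr.
intros; now rewrite h, h'.
Qed.

Lemma nat_trans_eq (E E' : Category) (F G : Functor E E') (s t : NatTrans F G) :
  (forall X, s X = t X) -> s = t.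
Proof.
destruct s as [s hs], t as [t ht]; simpl; intros h.
apply functional_extensionality_dep in h; subst t; f_equal; apply proof_irrelevance.
Qed.

Lemma bimonad_eq (B B' : Bimonad Z) :
  (forall X, mu B X = mu B' X) -> (forall X, eta B X = eta B' X) ->
  (forall X Y, cm2 (bm_comonoidal B) X Y = cm2 (bm_comonoidal B') X Y) ->
  cm0 (bm_comonoidal B) = cm0 (bm_comonoidal B') -> B = B'.
Proof.
destruct B as [[m e p1 p2 p3] [c2 c0 q1 q2 q3 q4] r1 r2],
  B' as [[m' e' p1' p2' p3'] [c2' c0' q1' q2' q3' q4'] r1' r2'];
    cbn [mu eta bm_monad bm_comonoidal cm2 cm0].
intros hm he h2 h0; apply nat_trans_eq in hm; apply nat_trans_eq in he.
assert (E : c2 = c2') by (do 2 (apply functional_extensionality_dep; intro); apply h2).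
clear h2; subst m' e' c2' c0'.
destruct (proof_irrelevance _ p1 p1'), (proof_irrelevance _ p2 p2'), (proof_irrelevance _ p3 p3').
destruct (proof_irrelevance _ q1 q1'), (proof_irrelevance _ q2 q2'), (proof_irrelevance _ q3 q3'),
 (proof_irrelevance _ q4 q4').
destruct (proof_irrelevance _ r1 r1'), (proof_irrelevance _ r2 r2'). reflexivity.
Qed.

Lemma centralizer_bimonad_unique (B B' : Bimonad Z) :
  is_centralizer_bimonad d B -> is_centralizer_bimonad d B' -> B = B'.
Proof.
intros h h'; apply bimonad_eq.
- intros X; apply bimonad_mu_uniq; now apply bimonad_mu_D.
- intros X; apply arr_inj; now rewrite !bimonad_eta_D.
- intros X Y; apply bimonad_cm2_uniq; now apply bimonad_cm2_D.
- apply bimonad_cm0_uniq; now apply bimonad_cm0_D.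
Qed.

Lemma centralizer_bimonad_exists : exists B : Bimonad Z, is_centralizer_bimonad d B.
Proof.
pose (m X := proj1_sig (constructive_indefinite_description _ (bimonad_mu_ex X))).
pose (c2 X Y := proj1_sig (constructive_indefinite_description _ (bimonad_cm2_ex X Y))).
destruct bimonad_cm0_ex as [c0 h0].
assert (hm : forall X, bimonad_mu_spec (m X)) by (intros X; exact (proj2_sig _)).
assert (h2 : forall X Y, bimonad_cm2_spec (c2 X Y)) by (intros X Y; exact (proj2_sig _)).
clearbody m c2.
pose (e X := lunit (Z X) ∘ d X 𝟙 ∘ runitV X).
assert (he : forall X, arr (e X) = D X 𝟙) by (intros X; unfold e; now untype).
pose (Mu X := arr (m X)); pose (Eta X := arr (e X)); pose (Cm2 X Y := arr (c2 X Y)).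
assert (tm : forall X, ty (Mu X) (Z (Z X)) (Z X)) by (intros; apply ty_arr).
assert (te : forall X, ty (Eta X) X (Z X)) by (intros; apply ty_arr).
assert (t2 : forall X Y, ty (Cm2 X Y) (Z (X ⊗ Y)) (Z X ⊗ Z Y)) by (intros; apply ty_arr).
assert (t0 : ty (arr c0) (Z 𝟙) 𝟙) by (intros; apply ty_arr).
assert (nm : forall (X Y : C) (f : X ~> Y),
  m Y ∘ fmap (functor_comp Z Z) f = fmap Z f ∘ m X).
{ intros X Y f; apply arr_inj; simpl; untype; exact (mu_law_natural tm hm (ty_arr f)). }
assert (ne : forall (X Y : C) (f : X ~> Y),
  e Y ∘ fmap (functor_id C) f = fmap Z f ∘ e X).
{ intros X Y f; apply arr_inj; simpl; untype; exact (eta_law_natural he (ty_arr f)). }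
pose (mN := @MkNatTrans C C (functor_comp Z Z) Z m nm).
pose (eN := @MkNatTrans C C (functor_id C) Z e ne).
assert (mA : forall X, m X ∘ fmap Z (m X) = m X ∘ m (Z X)).
{ intros X; apply arr_inj; untype; exact (mu_law_assoc tm hm X). }
assert (ml : forall X, m X ∘ e (Z X) = id (Z X)).
{ intros X; apply arr_inj; untype; exact (mu_law_etal tm hm he X). }
assert (mr : forall X, m X ∘ fmap Z (e X) = id (Z X)).
{ intros X; apply arr_inj; untype; exact (mu_law_etar tm hm he X). }
assert (cn : forall (X X' Y Y' : C) (f : X ~> X') (g : Y ~> Y'),
  c2 X' Y' ∘ fmap Z (f ⊠ g) = (fmap Z f ⊠ fmap Z g) ∘ c2 X Y).
{ intros; apply arr_inj; untype; exact (cm2_law_natural t2 h2 (ty_arr f) (ty_arr g)). }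
assert (cA : forall X Y V : C,
  assoc (Z X) (Z Y) (Z V) ∘ (c2 X Y ⊠ id (Z V)) ∘ c2 (X ⊗ Y) V
  = (id (Z X) ⊠ c2 Y V) ∘ c2 X (Y ⊗ V) ∘ fmap Z (assoc X Y V)).
{ intros; apply arr_inj; untype; rewrite <- cmpA.
  erewrite cmp_idr; [exact (cm2_law_coassoc t2 h2 _ _ _) | ty_infer | obj]. }
(* Untyped, [fmap Z (lunit X)] is the identity of [Z (𝟙 ⊗ X)], which [tensor1X] identifies with that
   of [Z X]. *)
assert (cl : forall X, lunit (Z X) ∘ (c0 ⊠ id (Z X)) ∘ c2 𝟙 X = fmap Z (lunit X)).
{ intros; apply arr_inj; untype;
    exact (eq_trans (cm2_law_counitl t2 t0 h2 h0 X) (f_equal (fun V => ida (Z V)) (eq_sym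
      (tensor1X X)))). }
assert (cr : forall X, runit (Z X) ∘ (id (Z X) ⊠ c0) ∘ c2 X 𝟙 = fmap Z (runit X)).
{ intros; apply arr_inj; untype;
    exact (eq_trans (cm2_law_counitr t2 t0 h2 h0 X) (f_equal (fun V => ida (Z V)) (eq_sym
      (tensorX1 X)))). }
pose (M := @MkMonad C Z mN eN mA ml mr).
pose (K := @MkComonoidal C C Z c2 c0 cn cA cl cr).
assert (b1 : is_comonoidal_trans (comonoidal_comp K K) K (mu M)).
{ split; intros; apply arr_inj; simpl; untype.
  - exact (mu_law_cm2 tm t2 hm h2 X Y).
  - exact (mu_law_cm0 tm t0 hm h0). }
assert (b2 : is_comonoidal_trans (comonoidal_id C) K (eta M)).
{ split; intros; apply arr_inj; simpl; untype.
  - exact (eta_law_cm2 te he h2 X Y).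
  - exact (eta_law_cm0 he h0). }
exists (@MkBimonad C Z M K b1 b2); split; intros; apply arr_inj; simpl; untype.
- rewrite <- !cmpA; apply hm.
- apply he.
- apply h2.
- exact (eq_trans (h0 _) (f_equal (@ida C) (eq_sym (tensor1X _)))).
Qed.
End CentralizerBimonad.

(** * Modules and half braidings *)

(** Objects agree only pointwise, so morphisms are compared through casts; after extensionality on
    objects these are identities. *)
Lemma functor_eq (C E : Category) (F G : Functor C E) (e : forall X, F X = G X) :
  (forall (X Y : C) (f : X ~> Y), idhom (e Y) ∘ fmap F f = fmap G f ∘ idhom (e X)) -> F = G.
Proof.
destruct F as [F Fm Fi Fc], G as [G Gm Gi Gc]; simpl in *.
assert (E' : F = G) by (apply functional_extensionality; exact e).
subst G; intros h.
assert (E' : Fm = Gm).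
{ do 3 (apply functional_extensionality_dep; intro).
  specialize (h x x0 x1); now rewrite !idhom_id, comp_idl, comp_idr in h. }
subst Gm; f_equal; apply proof_irrelevance.
Qed.

Lemma nat_iso_of_eq (C E : Category) (F G : Functor C E) :
  F = G -> exists t : NatTrans F G, is_nat_iso t.
Proof.
intros <-; unshelve eexists (@MkNatTrans C E F F (fun X => id (F X)) _).
- intros; now rewrite comp_idl, comp_idr.
- intros X; exact (idhom_is_iso (eq_refl (F X))).
Qed.

Lemma isomorphism_is_equivalence (C E : Category) (F : Functor C E) :
  is_isomorphism_of_categories F -> is_equivalence_of_categories F.
Proof.
intros [G [h k]]; exists G.
destruct (nat_iso_of_eq h) as [a ha], (nat_iso_of_eq k) as [b hb].
now exists a, b.
Qed.

Lemma is_iso_of_arr (C : Category) (X Y : C) (f : X ~> Y) a :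
  ty a Y X -> a ∙ arr f = ida X -> arr f ∙ a = ida Y -> is_iso f.
Proof.
intros [g ->] h k; exists g; split; apply arr_inj; untype; assumption.
Qed.

Section HalfBraiding.
Variables (C : StrictMonoidalCategory) (M : C) (s : forall Y : C, M ⊗ Y ~> Y ⊗ M).
Hypothesis hs : is_half_braiding s.

Lemma hb_arr_tensor Y Y' : arr (s (Y ⊗ Y')) = (Y ▹ arr (s Y')) ∙ (arr (s Y) ◃ Y').
Proof. rewrite (hb_tensor hs); untype; reflexivity. Qed.

Lemma hb_arr_unit : arr (s 𝟙) = ida M.
Proof.
pose proof (f_equal (fun f => arr f) (hb_unit hs)) as h; untype_in h.
exact (eq_trans h (f_equal (@ida C) (tensorX1 M))).
Qed.
End HalfBraiding.

Section CentralizerModules.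
Variables (C : StrictMonoidalCategory) (A : Autonomous C)
    (Z : Functor C C) (d : forall X Y : C, X ⊗ Y ~> Y ⊗ Z X)
    (dZ : is_centralizer d).
Variables (B : Bimonad Z) (hB : is_centralizer_bimonad d B).
Local Notation D := (univ d).
(** The endpoints are forced because [mu B X] starts at [functor_comp Z Z X], which is convertible
    but not syntactically equal to [Z (Z X)]. *)
Local Notation Mu X := (@arr C (Z (Z X)) (Z X) (mu B X)).
Local Notation Eta X := (@arr C X (Z X) (eta B X)).
Hint Resolve ty_univ : ty.

Lemma ty_Mu X : ty (Mu X) (Z (Z X)) (Z X). Proof. apply ty_arr. Qed.

Lemma ty_Eta X : ty (Eta X) X (Z X). Proof. apply ty_arr. Qed.

Hint Resolve ty_Mu ty_Eta : ty.
Local Notation Cm2 X Y := (arr (cm2 (bm_comonoidal B) X Y)).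
Local Notation Cm0 := (arr (cm0 (bm_comonoidal B))).

Lemma Cm2_D X X' Y : (Y ▹ Cm2 X X') ∙ D (X ⊗ X') Y = (D X Y ◃ Z X') ∙ (X ▹ D X' Y).
Proof. apply (bimonad_cm2_D hB). Qed.

Lemma Cm0_D Y : (Y ▹ Cm0) ∙ D 𝟙 Y = ida Y.
Proof. apply (bimonad_cm0_D hB). Qed.

Lemma Mu_D X Y Y' :
  ((Y ⊗ Y') ▹ Mu X) ∙ ((Y ▹ D (Z X) Y') ∙ (D X Y ◃ Y')) = D X (Y ⊗ Y').
Proof. apply (bimonad_mu_D hB). Qed.

Lemma Eta_D X : Eta X = D X 𝟙.
Proof. apply (bimonad_eta_D hB). Qed.

(** Defined for any arrow [r], so that each action law can be matched with one property of the
    family. *)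
Definition arr_braid (M : C) (r : arrow C) (Y : C) : arrow C := (Y ▹ r) ∙ D M Y.

Section Action.
Variables (M : C) (r : arrow C).
Hypothesis ty_r : ty r (Z M) M.
Hint Resolve ty_r : ty.

Lemma ty_arr_braid Y : ty (arr_braid M r Y) (M ⊗ Y) (Y ⊗ M).
Proof. unfold arr_braid; ty_solve. Qed.

Lemma arr_braid_nat Y Y' g : ty g Y Y' ->
  arr_braid M r Y' ∙ (M ▹ g) = (g ◃ M) ∙ arr_braid M r Y.
Proof.
intros tg; unfold arr_braid; nrm.
lrw (univ_natural_r dZ M tg).
lrw (slide tg ty_r).
reflexivity.
Qed.

Lemma arr_braid_tensor Y Y' : r ∙ amap Z r = r ∙ Mu M ->
  arr_braid M r (Y ⊗ Y') = (Y ▹ arr_braid M r Y') ∙ (arr_braid M r Y ◃ Y').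
Proof.
intros e; unfold arr_braid; nrm.
lrw (univ_natural_l dZ Y' ty_r) under Y, 𝟙.
lrw e under (Y ⊗ Y'), 𝟙.
lrw (Mu_D M Y Y').
reflexivity.
Qed.

Lemma arr_braid_unit : r ∙ Eta M = ida M -> arr_braid M r 𝟙 = ida M.
Proof. intros e; rewrite Eta_D in e; unfold arr_braid; nrm; exact e. Qed.

(** Composing with the universal families in two variables turns the action law into
    multiplicativity, and [univ2_unique] reflects it back. *)
Lemma act_mu_of_braid :
  (forall Y Y', arr_braid M r (Y ⊗ Y') = (Y ▹ arr_braid M r Y') ∙ (arr_braid M r Y ◃ Y')) ->
  r ∙ amap Z r = r ∙ Mu M.
Proof.
intros e; apply (@univ2_unique _ A _ _ dZ M M); try ty_solve; intros Y Y'; nrm.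
lrw <- (univ_natural_l dZ Y' ty_r) under Y, 𝟙.
lrw (Mu_D M Y Y').
specialize (e Y Y'); unfold arr_braid in e; nrm_in e; now symmetry.
Qed.

Lemma act_eta_of_braid : arr_braid M r 𝟙 = ida M -> r ∙ Eta M = ida M.
Proof. intros e; rewrite Eta_D; unfold arr_braid in e; nrm_in e; exact e. Qed.
End Action.

(** Follows from the defining equation of [Z_2] and interchange. It makes the functor to the center
    strict monoidal and later serves to test linearity of pairings. *)
Lemma arr_braid_cm2 M N r s Y : ty r (Z M) M -> ty s (Z N) N ->
  arr_braid (M ⊗ N) ((r ⊙ s) ∙ Cm2 M N) Y
  = (arr_braid M r Y ◃ N) ∙ (M ▹ arr_braid N s Y).
Proof.
intros tr ts; unfold arr_braid; nrm.
lrw (Cm2_D M N Y).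
lrw <- (slide (ty_univ d M Y) ts).
reflexivity.
Qed.

Lemma arr_braid_cm0 Y : arr_braid 𝟙 Cm0 Y = ida Y.
Proof. apply (bimonad_cm0_D hB). Qed.

Lemma arr_action_braid (M : module_cat B) Y :
  arr (action_braid d M Y) = arr_braid (mod_ob M) (arr (act M)) Y.
Proof. unfold action_braid; untype; reflexivity. Qed.

Lemma arr_act_mu (M : module_cat B) : arr (act M) ∙ amap Z (arr (act M))
  = arr (act M) ∙ Mu (mod_ob M).
Proof. rewrite <- arr_fmap, <- !arr_comp; f_equal; apply act_mu. Qed.

Lemma arr_act_eta (M : module_cat B) : arr (act M) ∙ Eta (mod_ob M) = ida (mod_ob M).
Proof. rewrite <- !arr_comp; unfold ida; f_equal; apply act_eta. Qed.

Lemma action_braid_half (M : module_cat B) : is_half_braiding (action_braid d M).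
Proof.
pose proof (ty_arr (act M)) as tr.
pose proof (fun Y Y' => arr_braid_tensor tr Y Y' (arr_act_mu M)) as ht.
pose proof (arr_braid_unit (arr_act_eta M)) as hu.
split.
- intros Y Y' f; apply arr_inj; untype; rewrite !arr_action_braid.
  exact (arr_braid_nat tr (ty_arr f)).
- intros Y; apply (@is_iso_of_arr _ _ _ _
    (right_inv A (mod_ob M) (arr_braid (mod_ob M) (arr (act M))) Y)).
  + apply ty_right_inv; exact (ty_arr_braid tr).
  + rewrite arr_action_braid; apply right_invK; auto using arr_braid_nat, ty_arr_braid.
  + rewrite arr_action_braid; apply right_invKr; auto using arr_braid_nat, ty_arr_braid.
- intros Y Y'; apply arr_inj; untype; rewrite !arr_action_braid; apply ht.
- apply arr_inj; untype; rewrite arr_action_braid, hu; now rewrite tensorX1.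
Qed.

(** * Half braidings as modules and the strict monoidal isomorphism *)

Lemma d_ext (X W : C) (r r' : Z X ~> W) :
  (forall Y, (id Y ⊠ r) ∘ d X Y = (id Y ⊠ r') ∘ d X Y) -> r = r'.
Proof.
intros h; apply arr_inj, (univ_unique dZ (ty_arr r) (ty_arr r')); intros Y.
exact (eq_trans (eq_sym (arr_comp _ _)) (eq_trans (f_equal (fun f => arr f) (h Y)) (arr_comp _ _))).
Qed.

Lemma center_act_ex (M : center_cat C) :
  exists r : Z (cen_ob M) ~> cen_ob M, forall Y, (id Y ⊠ r) ∘ d (cen_ob M) Y = braid M Y.
Proof.
destruct (@centralizer_universal _ _ _ dZ (cen_ob M) (cen_ob M) (braid M)) as [r [h _]].
- intros; apply (hb_natural (braid_half M)).
- now exists r.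
Qed.

Definition center_act (M : center_cat C) : Z (cen_ob M) ~> cen_ob M :=
  proj1_sig (constructive_indefinite_description _ (center_act_ex M)).

Lemma center_actE (M : center_cat C) Y :
  (id Y ⊠ center_act M) ∘ d (cen_ob M) Y = braid M Y.
Proof. exact (proj2_sig (constructive_indefinite_description _ (center_act_ex M)) Y). Qed.

Lemma center_act_uniq (M : center_cat C) (r : Z (cen_ob M) ~> cen_ob M) :
  (forall Y, (id Y ⊠ r) ∘ d (cen_ob M) Y = braid M Y) -> center_act M = r.
Proof. intros h; apply d_ext; intros Y; now rewrite h, center_actE. Qed.

Lemma arr_center_act (M : center_cat C) Y :
  arr_braid (cen_ob M) (arr (center_act M)) Y = arr (braid M Y).
Proof. unfold arr_braid, univ; rewrite <- center_actE; untype; reflexivity. Qed.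

Lemma center_act_mu (M : center_cat C) :
  center_act M ∘ fmap Z (center_act M) = center_act M ∘ mu B (cen_ob M).
Proof.
apply arr_inj; rewrite !arr_comp, arr_fmap; apply act_mu_of_braid; [apply ty_arr|].
intros Y Y'; rewrite !arr_center_act; apply hb_arr_tensor, braid_half.
Qed.

Lemma center_act_eta (M : center_cat C) :
  center_act M ∘ eta B (cen_ob M) = id (cen_ob M).
Proof.
apply arr_inj; rewrite !arr_comp; apply act_eta_of_braid.
rewrite !arr_center_act; apply hb_arr_unit, braid_half.
Qed.

Lemma center_act_linear (M N : center_cat C) (f : M ~> N) :
  cen_hom f ∘ center_act M = center_act N ∘ fmap Z (cen_hom f).
Proof.
apply d_ext; intros Y.
rewrite !tensor_compr, <- !compA, <- (centralizer_natural dZ), center_actE, compA, center_actE.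
apply cen_hom_braid.
Qed.

Definition center_module (M : center_cat C) : module_cat B :=
  @MkModule C Z B (cen_ob M) (center_act M) (center_act_mu M) (center_act_eta M).
Definition center_module_hom (M N : center_cat C) (f : M ~> N) :
    center_module M ~> center_module N :=
  @MkModuleHom C Z B (center_module M) (center_module N) (cen_hom f) (center_act_linear f).
Definition center_to_module : Functor (center_smc C) (module_smc B).
Proof.
refine (@MkFunctor (center_smc C) (module_smc B) center_module center_module_hom _ _);
  abstract (intros; now apply module_hom_eq).
Defined.

Local Notation to_center := (module_to_center dZ action_braid_half).

Lemma module_to_center_isomorphism : is_isomorphism_of_categories to_center.
Proof.
exists center_to_module; split.
- assert (e : forall M : module_cat B, center_module (module_to_center_ob action_braid_half M) = M).
  (* The carriers coincide by computation; the actions agree because a half braiding determines its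
     action. *)
  { intros M; apply (@module_eq _ _ _ (center_module
      (module_to_center_ob action_braid_half M)) M eq_refl).
    simpl; rewrite comp_idl, fmap_id, comp_idr.
    now apply (@center_act_uniq (module_to_center_ob action_braid_half M)). }
  apply (@functor_eq (module_cat B) (module_cat B) (functor_comp center_to_module to_center)
    (functor_id _) e).
  intros M N f; apply module_hom_eq; simpl.
  rewrite !module_idhom, !idhom_id; apply eq_trans with (mod_hom f); [apply comp_idl | symmetry;
    apply comp_idr].
- assert (e : forall M : center_cat C, module_to_center_ob action_braid_half (center_module M) = M).
  { intros M; apply (@center_eq _ (module_to_center_ob action_braid_half
      (center_module M)) M eq_refl).
    intros Y; simpl; rewrite !tensor_id, comp_idl, comp_idr; apply center_actE. }
  apply (@functor_eq (center_cat C) (center_cat C) (functor_comp to_center center_to_module)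
    (functor_id _) e).
  intros M N f; apply center_hom_eq; simpl.
  rewrite !center_idhom, !idhom_id; apply eq_trans with (cen_hom f); [apply comp_idl | symmetry;
    apply comp_idr].
Qed.

Lemma module_to_center_strict : is_strict_monoidal to_center.
Proof.
assert (e2 : forall M N : module_cat B,
  center_tensor (module_to_center_ob action_braid_half M) (module_to_center_ob action_braid_half N)
  = module_to_center_ob action_braid_half (module_tensor M N)).
{ intros M N; apply (@center_eq _ (center_tensor (module_to_center_ob action_braid_half M)
    (module_to_center_ob action_braid_half N)) (module_to_center_ob action_braid_half
      (module_tensor M N)) eq_refl).
  intros Y; simpl; rewrite !tensor_id, comp_idl, comp_idr.
  apply arr_inj; rewrite (arr_action_braid (module_tensor M N)).
  unfold center_tensor_braid; cbn [braid cen_ob module_to_center_ob]; untype.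
  rewrite !arr_action_braid; symmetry; cbn [mod_ob act module_tensor]; untype.
  exact (arr_braid_cm2 Y (ty_arr (act M)) (ty_arr (act N))). }
assert (e0 : center_unit C = module_to_center_ob action_braid_half (module_unit B)).
{ apply (@center_eq _ (center_unit C) (module_to_center_ob action_braid_half
    (module_unit B)) eq_refl).
  intros Y; simpl; rewrite !tensor_id, comp_idl, comp_idr.
  apply arr_inj; rewrite (arr_action_braid (module_unit B)).
  unfold center_unit_braid; untype; symmetry.
  exact (eq_trans (arr_braid_cm0 Y) (f_equal (@ida C) (eq_sym (tensor1X Y)))). }
exists e2, e0; intros M M' N N' f g; apply center_hom_eq; simpl.
rewrite !center_idhom, !idhom_id.
apply eq_trans with (mod_hom f ⊠ mod_hom g); [apply comp_idl | symmetry; apply comp_idr].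
Qed.

(** * Free modules, the adjunction and monadicity *)

Definition free_module (X : C) : module_cat B :=
  @MkModule C Z B (Z X) (mu B X) (muA B X) (mu_etal B X).
Definition free_hom (X Y : C) (f : X ~> Y) : free_module X ~> free_module Y :=
  @MkModuleHom C Z B (free_module X) (free_module Y) (fmap Z f) (eq_sym (nt_natural (mu B) f)).
Definition free_functor : Functor C (module_cat B).
Proof.
refine (@MkFunctor C (module_cat B) free_module free_hom _ _);
  abstract (intros; apply module_hom_eq; simpl; first [apply fmap_id | apply fmap_comp]).
Defined.

Definition free_center : Functor C (center_cat C) := functor_comp to_center free_functor.

Lemma center_counit_braid (M : center_cat C) (Y : C) :
  (id Y ⊠ center_act M) ∘ braid (free_center (cen_ob M)) Y
  = braid M Y ∘ (center_act M ⊠ id Y).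
Proof.
simpl; unfold action_braid; simpl.
rewrite <- (center_actE M Y), <- compA, (centralizer_natural dZ), !compA, <- !tensor_compr.
now rewrite center_act_mu.
Qed.

Definition center_counit_hom (M : center_cat C) : free_center (cen_ob M) ~> M :=
  @MkCenterHom C (free_center (cen_ob M)) M (center_act M) (center_counit_braid M).

(** [center_act] comes from a choice, so this holds by uniqueness and not by computation. *)
Lemma center_act_free X : center_act (free_center X) = mu B X.
Proof. now apply (@center_act_uniq (free_center X)). Qed.

(** The counit at [M] is the action of [M], so the triangles are the unit laws of the monad and of
    its modules. *)
Definition free_adjunction : Adjunction free_center (center_forget C).
Proof.
unshelve refine (@MkAdjunction C (center_cat C) free_center (center_forget C)
  (@MkNatTrans C C (functor_id C) (functor_comp (center_forget C) free_center) (eta B) _)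
  (@MkNatTrans (center_cat C) (center_cat C) (functor_comp free_center (center_forget C))
    (functor_id _) center_counit_hom _) _ _).
- exact (nt_natural (eta B)).
- abstract (intros M N f; apply center_hom_eq; symmetry; apply center_act_linear).
- abstract (intros X; apply center_hom_eq; simpl;
    exact (eq_trans (f_equal (fun m => m ∘ fmap Z (eta B X)) (center_act_free X)) (mu_etar B X))).
- abstract (intros M; apply center_act_eta).
Defined.

Lemma adj_monad_mu X : mu (adj_monad free_adjunction) X = mu B X.
Proof. exact (center_act_free X). Qed.

(** The two endofunctors have the same values by computation, but their products agree only by
    [adj_monad_mu], along which the action law is transported. *)
Definition of_adj_module (N : module_cat (adj_monad free_adjunction)) : module_cat B :=
  @MkModule C Z B (mod_ob N) (act N)
    (eq_trans (act_mu N) (f_equal (fun m => act N ∘ m) (adj_monad_mu (mod_ob N)))) (act_eta N).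
Definition of_adj_hom (M N : module_cat (adj_monad free_adjunction)) (f : M ~> N) :
    of_adj_module M ~> of_adj_module N :=
  @MkModuleHom C Z B (of_adj_module M) (of_adj_module N) (mod_hom f) (mod_hom_linear f).
Definition of_adj : Functor (module_cat (adj_monad free_adjunction)) (center_cat C).
Proof.
refine (functor_comp to_center (@MkFunctor _ (module_cat B) of_adj_module of_adj_hom _ _));
  abstract (intros; now apply module_hom_eq).
Defined.

Lemma comparison_isomorphism : is_isomorphism_of_categories (comparison free_adjunction).
Proof.
exists of_adj; split.
- assert (e : forall M : center_cat C, of_adj (comparison free_adjunction M) = M).
  { intros M; apply (@center_eq _ (of_adj (comparison free_adjunction M)) M eq_refl).
    intros Y; simpl; rewrite !tensor_id, comp_idl, comp_idr; apply center_actE. }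
  apply (functor_eq (F := functor_comp of_adj (comparison free_adjunction)) (G :=
    functor_id _) (e := e)).
  intros M N f; apply center_hom_eq; simpl.
  rewrite !center_idhom, !idhom_id; apply eq_trans with (cen_hom f); [apply comp_idl | symmetry;
    apply comp_idr].
- assert (e : forall N, comparison free_adjunction (of_adj N) = N).
  { intros N; apply (@module_eq _ _ _ (comparison free_adjunction (of_adj N)) N eq_refl).
    simpl; rewrite comp_idl, fmap_id, comp_idr.
    now apply (@center_act_uniq (of_adj N)). }
  apply (functor_eq (F := functor_comp (comparison free_adjunction) of_adj) (G :=
    functor_id _) (e := e)).
  intros M N f; apply module_hom_eq; simpl.
  rewrite !module_idhom, !idhom_id; apply eq_trans with (mod_hom f); [apply comp_idl | symmetry;
    apply comp_idr].
Qed.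

Lemma center_forget_monadic : is_monadic_with_monad (center_forget C) B.
Proof.
exists free_center, free_adjunction; split.
- apply isomorphism_is_equivalence, comparison_isomorphism.
- unshelve eexists (@MkNatTrans C C (functor_comp (center_forget C) free_center) Z (fun X => id
    (Z X)) _).
  + intros X Y f; exact (eq_trans (comp_idl _) (eq_sym (comp_idr _))).
  + split.
    * intros X; exact (idhom_is_iso (eq_refl (Z X))).
    * intros X; cbn [nt_app]; rewrite fmap_id, comp_idl.
      refine (eq_trans (adj_monad_mu X) (eq_sym _)).
      exact (eq_trans (f_equal (fun m => mu B X ∘ m) (comp_idl _)) (comp_idr _)).
    * intros X; exact (comp_idl _).
Qed.

(** * Antipodes *)

Section Pairings.
Variables (P Q : C) (p q : arrow C).
Hypothesis ty_p : ty p (Z P) P.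
Hypothesis ty_q : ty q (Z Q) Q.
Hint Resolve ty_p ty_q : ty.

(** Composed with [D (P ⊗ Q) Y], linearity of [e] becomes [h]: a strand [Y] that crosses [P] and [Q]
    can be pulled past [e]. *)
Lemma pairing_linear e : ty e (P ⊗ Q) 𝟙 ->
  (forall Y, (Y ▹ e) ∙ ((arr_braid P p Y ◃ Q) ∙ (P ▹ arr_braid Q q Y)) = e ◃ Y) ->
  Cm0 ∙ amap Z e = e ∙ ((p ⊙ q) ∙ Cm2 P Q).
Proof.
intros te h; apply (@univ_unique _ _ _ dZ (P ⊗ Q) 𝟙); try ty_solve; intros Y; nrm.
lrw <- (univ_natural_l dZ Y te).
lrw (Cm0_D Y).
specialize (h Y); rewrite <- (arr_braid_cm2 Y ty_p ty_q) in h; unfold arr_braid in h; nrm_in h.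
now symmetry.
Qed.

Lemma copairing_linear c : ty c 𝟙 (P ⊗ Q) ->
  (forall Y, ((arr_braid P p Y ◃ Q) ∙ (P ▹ arr_braid Q q Y)) ∙ (c ◃ Y) = Y ▹ c) ->
  c ∙ Cm0 = ((p ⊙ q) ∙ Cm2 P Q) ∙ amap Z c.
Proof.
intros tc h; apply (@univ_unique _ _ _ dZ 𝟙 (P ⊗ Q)); try ty_solve; intros Y.
nrm.
lrw <- (univ_natural_l dZ Y tc).
lrw (Cm0_D Y).
specialize (h Y); rewrite <- (arr_braid_cm2 Y ty_p ty_q) in h; unfold arr_braid in h; nrm_in h.
now symmetry.
Qed.
End Pairings.

(** * Dual actions on the duals of free modules *)

Notation L := (ldual A). Notation R := (rdual A).
Notation free_braid X := (arr_braid (Z X) (Mu X)).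

Lemma ty_free_braid X Y : ty (free_braid X Y) (Z X ⊗ Y) (Y ⊗ Z X).
Proof. apply ty_arr_braid, ty_Mu. Qed.

Lemma free_braid_natural X Y Y' g : ty g Y Y' ->
  free_braid X Y' ∙ (Z X ▹ g) = (g ◃ Z X) ∙ free_braid X Y.
Proof. apply arr_braid_nat, ty_Mu. Qed.

Lemma free_braid_tensor X Y Y' : free_braid X (Y ⊗ Y')
  = (Y ▹ free_braid X Y') ∙ (free_braid X Y ◃ Y').
Proof. apply arr_braid_tensor; [apply ty_Mu | apply (arr_act_mu (free_module X))]. Qed.

Lemma free_braid_unit X : free_braid X 𝟙 = ida (Z X).
Proof. apply arr_braid_unit, (arr_act_eta (free_module X)). Qed.

Definition free_braid_inv X := right_inv A (Z X) (free_braid X).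

Lemma ty_free_braid_inv X Y : ty (free_braid_inv X Y) (Y ⊗ Z X) (Z X ⊗ Y).
Proof. apply ty_right_inv, ty_free_braid. Qed.

Lemma free_braid_invK X Y : free_braid_inv X Y ∙ free_braid X Y = ida (Z X ⊗ Y).
Proof. apply right_invK; [apply ty_free_braid | apply free_braid_natural |
  apply free_braid_tensor | apply free_braid_unit]. Qed.

Lemma free_braidK X Y : free_braid X Y ∙ free_braid_inv X Y = ida (Y ⊗ Z X).
Proof. apply right_invKr; [apply ty_free_braid | apply free_braid_natural |
  apply free_braid_tensor | apply free_braid_unit]. Qed.

Hint Resolve ty_free_braid ty_free_braid_inv : ty.

(** Conjugates a commutative square by inverses, so that naturality of a family passes to its
    inverse. *)
Lemma cmp_conj (P P' Q Q' : C) (a a' b b' x y : arrow C) :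
  ty a Q Q' -> ty a' Q' Q -> ty b P P' -> ty b' P' P -> ty x P Q -> ty y P' Q' ->
  a' ∙ a = ida Q -> b ∙ b' = ida P' -> a ∙ x = y ∙ b -> x ∙ b' = a' ∙ y.
Proof.
intros ta ta' tb tb' tx ty' h k e.
rewrite <- (cmp_idr ty' eq_refl), <- k, (cmpA y), <- e, !cmpA, h.
now rewrite (cmp_idl tx eq_refl).
Qed.

(** Linear maps between free modules; the instances used are [Z f] and [mu]. *)
Definition free_map X X' f := ty f (Z X) (Z X') /\ f ∙ Mu X = Mu X' ∙ amap Z f.

Lemma free_map_amap X X' f : ty f X X' -> free_map X X' (amap Z f).
Proof.
intros tf; split; [ty_solve|]; symmetry.
exact (mu_law_natural A dZ ty_Mu Mu_D tf).
Qed.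

Lemma free_map_mu X : free_map (Z X) X (Mu X).
Proof. split; [apply ty_Mu | symmetry; exact (mu_law_assoc A dZ ty_Mu Mu_D X)]. Qed.

Lemma free_map_braid X X' f Y : free_map X X' f ->
  free_braid X' Y ∙ (f ◃ Y) = (Y ▹ f) ∙ free_braid X Y.
Proof.
intros [tf e]; unfold arr_braid; nrm.
lrw (univ_natural_l dZ Y tf). lrw e under Y, 𝟙.
reflexivity.
Qed.

Lemma free_map_braid_inv X X' f Y : free_map X X' f ->
  free_braid_inv X' Y ∙ (Y ▹ f) = (f ◃ Y) ∙ free_braid_inv X Y.
Proof.
intros h; symmetry; pose proof (proj1 h) as tf.
apply (@cmp_conj (Z X ⊗ Y) (Y ⊗ Z X) (Z X' ⊗ Y) (Y ⊗ Z X') (free_braid X' Y) _ (free_braid X Y));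
  try ty_solve; auto using free_braid_invK, free_braidK, free_map_braid.
Qed.

Lemma free_braid_inv_natural X Y Y' g : ty g Y Y' ->
  free_braid_inv X Y' ∙ (g ◃ Z X) = (Z X ▹ g) ∙ free_braid_inv X Y.
Proof.
intros tg; symmetry.
apply (@cmp_conj (Z X ⊗ Y) (Y ⊗ Z X) (Z X ⊗ Y') (Y' ⊗ Z X) (free_braid X Y') _ (free_braid X Y));
  try ty_solve; auto using free_braid_invK, free_braidK, free_braid_natural.
Qed.

Definition ldual_braid X := left_mate A (Z X) (free_braid_inv X).

Lemma ty_ldual_braid X Y : ty (ldual_braid X Y) (L (Z X) ⊗ Y) (Y ⊗ L (Z X)).
Proof. apply ty_left_mate, ty_free_braid_inv. Qed.

Hint Resolve ty_ldual_braid : ty.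

Definition rdual_braid_inv X := right_mate A (Z X) (free_braid X).

Lemma ty_rdual_braid_inv X Y : ty (rdual_braid_inv X Y) (Y ⊗ R (Z X)) (R (Z X) ⊗ Y).
Proof. apply ty_right_mate, ty_free_braid. Qed.

Lemma rdual_braid_inv_natural X Y Y' g : ty g Y Y' ->
  rdual_braid_inv X Y' ∙ (g ◃ R (Z X)) = (R (Z X) ▹ g) ∙ rdual_braid_inv X Y.
Proof. intros tg; apply right_mate_nat; auto using ty_free_braid, free_braid_natural. Qed.

(* Transposing a half braiding along the right dual produces a family in the opposite
   direction, which has to be inverted; along the left dual it is the inverse half
   braiding that is transposed. *)
Definition rdual_braid X := left_inv A (R (Z X)) (rdual_braid_inv X).

Lemma ty_rdual_braid X Y : ty (rdual_braid X Y) (R (Z X) ⊗ Y) (Y ⊗ R (Z X)).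
Proof. apply ty_left_inv, ty_rdual_braid_inv. Qed.

Hint Resolve ty_rdual_braid_inv ty_rdual_braid : ty.

Lemma rdual_braidK X Y : rdual_braid X Y ∙ rdual_braid_inv X Y = ida (Y ⊗ R (Z X)).
Proof.
apply left_invK; [apply ty_rdual_braid_inv | apply rdual_braid_inv_natural | intros;
  apply right_mate_tensor | apply right_mate_unit, free_braid_unit].
apply ty_free_braid. apply free_braid_tensor.
Qed.

Lemma rdual_braid_invK X Y : rdual_braid_inv X Y ∙ rdual_braid X Y = ida (R (Z X) ⊗ Y).
Proof.
apply left_invKr; [apply ty_rdual_braid_inv | apply rdual_braid_inv_natural | intros;
  apply right_mate_tensor | apply right_mate_unit, free_braid_unit].
apply ty_free_braid. apply free_braid_tensor.
Qed.

Lemma ldual_act_exists X : exists r : Z (L (Z X)) ~> L (Z X),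
  forall Y, arr_braid (L (Z X)) (arr r) Y = ldual_braid X Y.
Proof.
destruct (@univ_exists _ _ _ dZ (L (Z X)) (L (Z X)) (ldual_braid X)) as [r [[m ->] h]].
- apply ty_ldual_braid.
- intros Y Y' g tg; apply left_mate_nat; auto using free_braid_inv_natural, ty_free_braid_inv.
- now exists m.
Qed.

Lemma rdual_act_exists X : exists r : Z (R (Z X)) ~> R (Z X),
  forall Y, arr_braid (R (Z X)) (arr r) Y = rdual_braid X Y.
Proof.
destruct (@univ_exists _ _ _ dZ (R (Z X)) (R (Z X)) (rdual_braid X)) as [r [[m ->] h]].
- apply ty_rdual_braid.
- intros Y Y' g tg; symmetry.
  apply (@cmp_conj (Y ⊗ R (Z X)) (R (Z X) ⊗ Y) (Y' ⊗ R (Z X)) (R (Z X) ⊗ Y')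
    (rdual_braid_inv X Y') _ (rdual_braid_inv X Y));
  try ty_solve; auto using rdual_braidK, rdual_braid_invK, rdual_braid_inv_natural.
- now exists m.
Qed.

Definition ldual_act X := proj1_sig (constructive_indefinite_description _ (ldual_act_exists X)).
Definition rdual_act X := proj1_sig (constructive_indefinite_description _ (rdual_act_exists X)).

Lemma ldual_act_braid X Y : arr_braid (L (Z X)) (arr (ldual_act X)) Y = ldual_braid X Y.
Proof. exact (proj2_sig (constructive_indefinite_description _ (ldual_act_exists X)) Y). Qed.

Lemma rdual_act_braid X Y : arr_braid (R (Z X)) (arr (rdual_act X)) Y = rdual_braid X Y.
Proof. exact (proj2_sig (constructive_indefinite_description _ (rdual_act_exists X)) Y). Qed.

Lemma ldual_act_univ X Y : (Y ▹ arr (ldual_act X)) ∙ D (L (Z X)) Y = ldual_braid X Y.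
Proof. exact (ldual_act_braid X Y). Qed.

Lemma rdual_act_univ X Y : (Y ▹ arr (rdual_act X)) ∙ D (R (Z X)) Y = rdual_braid X Y.
Proof. exact (rdual_act_braid X Y). Qed.

Local Notation Lact X := (arr (ldual_act X)).
Local Notation Ract X := (arr (rdual_act X)).

(** The dual of a linear map is linear for the dual actions, since mates are compatible with duals
    of morphisms. *)
Lemma ldual_act_map X X' f : free_map X X' f ->
  ldualmap A (Z X) (Z X') f ∙ Lact X' = Lact X ∙ amap Z (ldualmap A (Z X) (Z X') f).
Proof.
intros h; pose proof (proj1 h) as tf.
apply (@univ_unique _ _ _ dZ (L (Z X')) (L (Z X))); try ty_solve; intros Y; nrm.
lrw (ldual_act_univ X' Y).
lrw <- (univ_natural_l dZ Y (ty_ldualmap A tf)).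
lrw (ldual_act_univ X Y).
apply left_mate_map; auto using ty_free_braid_inv, free_map_braid_inv.
Qed.

Lemma rdual_act_map X X' f : free_map X X' f ->
  rdualmap A (Z X) (Z X') f ∙ Ract X' = Ract X ∙ amap Z (rdualmap A (Z X) (Z X') f).
Proof.
intros h; pose proof (proj1 h) as tf.
apply (@univ_unique _ _ _ dZ (R (Z X')) (R (Z X))); try ty_solve; intros Y; nrm.
lrw (rdual_act_univ X' Y).
lrw <- (univ_natural_l dZ Y (ty_rdualmap A tf)).
lrw (rdual_act_univ X Y).
(* [right_mate_map] concerns the families inverse to [rdual_braid], so the square is conjugated. *)
apply (@cmp_conj (Y ⊗ R (Z X')) (R (Z X') ⊗ Y) (Y ⊗ R (Z X)) (R (Z X) ⊗ Y)
  (rdual_braid_inv X Y) _ (rdual_braid_inv X' Y));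
  try ty_solve; auto using rdual_braidK, rdual_braid_invK.
symmetry; apply right_mate_map; auto using ty_free_braid, free_map_braid.
Qed.

Local Notation Ev := (Ev A).
Local Notation Coev := (Coev A).
Local Notation Rev := (Rev A).
Local Notation Rcoev := (Rcoev A).

Lemma ldual_braid_ev X Y : (Y ▹ Ev (Z X)) ∙ (ldual_braid X Y ◃ Z X)
  = (Ev (Z X) ◃ Y) ∙ (L (Z X) ▹ free_braid_inv X Y).
Proof. apply left_mate_ev, ty_free_braid_inv. Qed.

Lemma ldual_braid_coev X Y : (Z X ▹ ldual_braid X Y) ∙ (Coev (Z X) ◃ Y)
  = (free_braid_inv X Y ◃ L (Z X)) ∙ (Y ▹ Coev (Z X)).
Proof. apply left_mate_coev, ty_free_braid_inv. Qed.

Lemma rdual_braid_inv_ev X Y : (Rev (Z X) ◃ Y) ∙ (Z X ▹ rdual_braid_inv X Y)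
  = (Y ▹ Rev (Z X)) ∙ (free_braid X Y ◃ R (Z X)).
Proof. apply right_mate_ev, ty_free_braid. Qed.

Lemma rdual_braid_inv_coev X Y : (rdual_braid_inv X Y ◃ Z X) ∙ (Y ▹ Rcoev (Z X))
  = (R (Z X) ▹ free_braid X Y) ∙ (Rcoev (Z X) ◃ Y).
Proof. apply right_mate_coev, ty_free_braid. Qed.

(** Evaluation trades the dual half braiding for the inverse of the free one, which cancels. *)
Lemma ev_linear X : Cm0 ∙ amap Z (Ev (Z X)) = Ev (Z X) ∙ ((Lact X ⊙ Mu X) ∙ Cm2 (L (Z X)) (Z X)).
Proof.
apply pairing_linear; try ty_solve; intros Y; rewrite ldual_act_braid; nrm.
lrw (ldual_braid_ev X Y).
lrw (free_braid_invK X Y) under (L (Z X)), 𝟙.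
reflexivity.
Qed.

Lemma coev_linear X : Coev (Z X) ∙ Cm0
  = ((Mu X ⊙ Lact X) ∙ Cm2 (Z X) (L (Z X))) ∙ amap Z (Coev (Z X)).
Proof.
apply copairing_linear; try ty_solve; intros Y; rewrite ldual_act_braid; nrm.
lrw (ldual_braid_coev X Y).
lrw (free_braidK X Y) under 𝟙, (L (Z X)).
reflexivity.
Qed.

(** Here the free half braiding is traded for its transpose, which cancels against its inverse
    [rdual_braid]. *)
Lemma rev_linear X : Cm0 ∙ amap Z (Rev (Z X)) = Rev (Z X) ∙ ((Mu X ⊙ Ract X) ∙ Cm2 (Z X) (R (Z X))).
Proof.
apply pairing_linear; try ty_solve; intros Y; rewrite rdual_act_braid; nrm.
lrw <- (rdual_braid_inv_ev X Y).
lrw (rdual_braid_invK X Y) under (Z X), 𝟙.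
reflexivity.
Qed.

Lemma rcoev_linear X : Rcoev (Z X) ∙ Cm0
  = ((Ract X ⊙ Mu X) ∙ Cm2 (R (Z X)) (Z X)) ∙ amap Z (Rcoev (Z X)).
Proof.
apply copairing_linear; try ty_solve; intros Y; rewrite rdual_act_braid; nrm.
lrw <- (rdual_braid_inv_coev X Y).
lrw (rdual_braidK X Y) under 𝟙, (Z X).
reflexivity.
Qed.

Lemma Cm2_natl X X' Y f : ty f X X' ->
  Cm2 X' Y ∙ amap Z (f ◃ Y) = (amap Z f ◃ Z Y) ∙ Cm2 X Y.
Proof.
intros [g ->]; rewrite <- arr_fmap, <- !arr_rw, <- arr_fmap, <- !arr_comp; f_equal.
symmetry; apply cm2_natural_l.
Qed.

Lemma Cm2_natr X Y Y' f : ty f Y Y' ->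
  Cm2 X Y' ∙ amap Z (X ▹ f) = (Z X ▹ amap Z f) ∙ Cm2 X Y.
Proof.
intros [g ->]; rewrite <- arr_fmap, <- !arr_lw, <- arr_fmap, <- !arr_comp; f_equal.
symmetry; apply cm2_natural_r.
Qed.

Lemma Mu_etar X : Mu X ∙ amap Z (Eta X) = ida (Z X).
Proof. exact (eq_trans (eq_sym (arr_comp _ _)) (f_equal (fun f => arr f) (mu_etar B X))). Qed.

Lemma Mu_etal X : Mu X ∙ Eta (Z X) = ida (Z X).
Proof. exact (eq_trans (eq_sym (arr_comp _ _)) (f_equal (fun f => arr f) (mu_etal B X))). Qed.

Lemma Eta_nat X Y f : ty f X Y -> Eta Y ∙ f = amap Z f ∙ Eta X.
Proof.
intros [g ->]; exact (eq_trans (eq_sym (arr_comp _ _))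
  (eq_trans (f_equal (fun f => arr f) (nt_natural (eta B) g)) (arr_comp _ _))).
Qed.

Local Notation LD X Y f := (ldualmap A X Y f).
Local Notation RD X Y f := (rdualmap A X Y f).

(** * The antipode axioms *)

Definition lantipode X := LD X (Z X) (Eta X) ∙ Lact X.
Definition rantipode X := RD X (Z X) (Eta X) ∙ Ract X.

Lemma lantipode_natural X Y f : ty f X Y ->
  lantipode X ∙ amap Z (LD (Z X) (Z Y) (amap Z f)) = LD X Y f ∙ lantipode Y.
Proof.
intros tf; unfold lantipode.
rewrite <- cmpA, <- (ldual_act_map (free_map_amap tf)), !cmpA; f_equal.
rewrite <- (ldualmap_cmp A (ty_Eta X) (ty_amap Z tf)), <- (ldualmap_cmp A tf (ty_Eta Y)).
now rewrite (Eta_nat tf).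
Qed.

Lemma rantipode_natural X Y f : ty f X Y ->
  rantipode X ∙ amap Z (RD (Z X) (Z Y) (amap Z f)) = RD X Y f ∙ rantipode Y.
Proof.
intros tf; unfold rantipode.
rewrite <- cmpA, <- (rdual_act_map (free_map_amap tf)), !cmpA; f_equal.
rewrite <- (rdualmap_cmp A (ty_Eta X) (ty_amap Z tf)), <- (rdualmap_cmp A tf (ty_Eta Y)).
now rewrite (Eta_nat tf).
Qed.

(** The composite in the evaluation axiom collapses to the dual action, because the dual of [mu] is
    linear and [mu X ∘ eta (Z X)] is an identity. *)
Lemma lantipode_mu X : lantipode (Z X) ∙ amap Z (LD (Z (Z X)) (Z X) (Mu X)) = Lact X.
Proof.
unfold lantipode; rewrite <- cmpA, <- (ldual_act_map (free_map_mu X)), !cmpA.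
rewrite <- (ldualmap_cmp A (ty_Eta (Z X)) (ty_Mu X)), Mu_etal, ldualmap_id.
apply (cmp_idl (ty_arr _) eq_refl).
Qed.

Lemma rantipode_mu X : rantipode (Z X) ∙ amap Z (RD (Z (Z X)) (Z X) (Mu X)) = Ract X.
Proof.
unfold rantipode; rewrite <- cmpA, <- (rdual_act_map (free_map_mu X)), !cmpA.
rewrite <- (rdualmap_cmp A (ty_Eta (Z X)) (ty_Mu X)), Mu_etal, rdualmap_id.
apply (cmp_idl (ty_arr _) eq_refl).
Qed.

(** Linearity of evaluation precomposed with [Z (L (Z X) ▹ Eta X)]: on the left the unit passes to
    its dual, on the right it cancels against [Mu X]. *)
Lemma lantipode_ev X :
  (Cm0 ∙ amap Z (Ev X)) ∙ amap Z (LD X (Z X) (Eta X) ◃ X)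
  = (Ev (Z X) ∙ ((lantipode (Z X) ∙ amap Z (LD (Z (Z X)) (Z X) (Mu X))) ◃ Z X)) ∙ Cm2 (L (Z X)) X.
Proof.
rewrite lantipode_mu, <- cmpA.
erewrite <- amap_cmp; [|ty_infer|ty_infer|obj].
rewrite (Ev_ldualmap A (ty_Eta X)).
erewrite amap_cmp; [|ty_infer|ty_infer|obj].
rewrite cmpA, ev_linear; nrm.
lrw (Cm2_natr (L (Z X)) (ty_Eta X)).
lrw (Mu_etar X) under (Z (L (Z X))), 𝟙.
reflexivity.
Qed.

Lemma rantipode_ev X :
  (Cm0 ∙ amap Z (Rev X)) ∙ amap Z (X ▹ RD X (Z X) (Eta X))
  = (Rev (Z X) ∙ (Z X ▹ (rantipode (Z X) ∙ amap Z (RD (Z (Z X)) (Z X) (Mu X))))) ∙ Cm2 X (R (Z X)).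
Proof.
rewrite rantipode_mu, <- cmpA.
erewrite <- amap_cmp; [|ty_infer|ty_infer|obj].
rewrite (Rev_rdualmap A (ty_Eta X)).
erewrite amap_cmp; [|ty_infer|ty_infer|obj].
rewrite cmpA, rev_linear; nrm.
lrw (Cm2_natl (R (Z X)) (ty_Eta X)).
lrw <- (slide (ty_amap Z (ty_Eta X)) (ty_arr (rdual_act X))).
lrw (Mu_etar X) under 𝟙, (R (Z X)).
reflexivity.
Qed.

(** Linearity of coevaluation followed by the dual of [Eta X] on the dual factor. *)
Lemma lantipode_coev X :
  ((Eta X ◃ L X) ∙ Coev X) ∙ Cm0
  = ((Mu X ⊙ lantipode X) ∙ Cm2 (Z X) (L (Z X))) ∙ amap Z (Coev (Z X)).
Proof.
unfold lantipode.
rewrite <- (Coev_ldualmap A (ty_Eta X)), <- cmpA, coev_linear; nrm.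
lrw <- (slide (ty_Mu X) (ty_ldualmap A (ty_Eta X))).
reflexivity.
Qed.

Lemma rantipode_coev X :
  ((R X ▹ Eta X) ∙ Rcoev X) ∙ Cm0
  = ((rantipode X ⊙ Mu X) ∙ Cm2 (R (Z X)) (Z X)) ∙ amap Z (Rcoev (Z X)).
Proof.
unfold rantipode.
rewrite <- (Rcoev_rdualmap A (ty_Eta X)), <- cmpA, rcoev_linear; nrm. reflexivity.
Qed.

Definition left_antipode X : Z (L (Z X)) ~> L X := @ldual_hom C A X (Z X) (eta B X) ∘ ldual_act X.

Lemma arr_left_antipode X : arr (left_antipode X) = lantipode X.
Proof.
unfold left_antipode; rewrite arr_comp.
exact (f_equal (fun a => a ∙ Lact X) (@arr_ldual_hom C A X (Z X) (eta B X))).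
Qed.

Lemma left_antipodeP : is_left_antipode B left_antipode.
Proof.
(* The axioms are restated with explicit endpoints, because [eta] and [mu] mention [functor_id] and
   [functor_comp]; conversion identifies the two forms at the end. *)
assert (n : forall (X Y : C) (f : X ~> Y),
  left_antipode X ∘ fmap Z (@ldual_hom C A (Z X) (Z Y) (fmap Z f))
    = @ldual_hom C A X Y f ∘ left_antipode Y).
{ intros X Y f; apply arr_inj; untype; rewrite !arr_left_antipode, !arr_ldual_hom.
  exact (lantipode_natural (ty_arr f)). }
assert (e : forall X : C,
  cm0 (bm_comonoidal B) ∘ fmap Z (ev A X) ∘ fmap Z (@ldual_hom C A X (Z X) (eta B X) ⊠ id X)
  = ev A (Z X) ∘ ((left_antipode (Z X) ∘ fmap Z (@ldual_hom C A (Z (Z X)) (Z X) (mu B X))) ⊠ id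
    (Z X))
    ∘ cm2 (bm_comonoidal B) (L (Z X)) X).
{ intros X; apply arr_inj; untype; rewrite !arr_left_antipode, !arr_ldual_hom.
  exact (lantipode_ev X). }
assert (c : forall X : C,
  ((eta B X : X ~> Z X) ⊠ id (L X)) ∘ coev A X ∘ cm0 (bm_comonoidal B)
  = ((mu B X : Z (Z X) ~> Z X) ⊠ left_antipode X) ∘ cm2 (bm_comonoidal B) (Z X) (L
    (Z X)) ∘ fmap Z (coev A (Z X))).
{ intros X; apply arr_inj; untype; rewrite !arr_left_antipode; exact (lantipode_coev X). }
split; assumption.
Qed.

Definition right_antipode X : Z (R (Z X)) ~> R X := @rdual_hom C A X (Z X) (eta B X) ∘ rdual_act X.

Lemma arr_right_antipode X : arr (right_antipode X) = rantipode X.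
Proof.
unfold right_antipode; rewrite arr_comp.
exact (f_equal (fun a => a ∙ Ract X) (@arr_rdual_hom C A X (Z X) (eta B X))).
Qed.

Lemma right_antipodeP : is_right_antipode B right_antipode.
Proof.
assert (n : forall (X Y : C) (f : X ~> Y),
  right_antipode X ∘ fmap Z (@rdual_hom C A (Z X) (Z Y) (fmap Z f))
    = @rdual_hom C A X Y f ∘ right_antipode Y).
{ intros X Y f; apply arr_inj; untype; rewrite !arr_right_antipode, !arr_rdual_hom.
  exact (rantipode_natural (ty_arr f)). }
assert (e : forall X : C,
  cm0 (bm_comonoidal B) ∘ fmap Z (rev A X) ∘ fmap Z (id X ⊠ @rdual_hom C A X (Z X) (eta B X))
  = rev A (Z X) ∘ (id (Z X) ⊠ (right_antipode (Z X) ∘ fmap Z (@rdual_hom C A (Z (Z X)) (Z X)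
    (mu B X))))
    ∘ cm2 (bm_comonoidal B) X (R (Z X))).
{ intros X; apply arr_inj; untype; rewrite !arr_right_antipode, !arr_rdual_hom.
  exact (rantipode_ev X). }
assert (c : forall X : C,
  (id (R X) ⊠ (eta B X : X ~> Z X)) ∘ rcoev A X ∘ cm0 (bm_comonoidal B)
  = (right_antipode X ⊠ (mu B X : Z (Z X) ~> Z X)) ∘ cm2 (bm_comonoidal B) (R (Z X))
    (Z X) ∘ fmap Z (rcoev A (Z X))).
{ intros X; apply arr_inj; untype; rewrite !arr_right_antipode; exact (rantipode_coev X). }
split; assumption.
Qed.

End CentralizerModules.

Theorem corollary5p14 (C : StrictMonoidalCategory) (A : Autonomous C)
    (Z : Functor C C) (d : forall X Y : C, X ⊗ Y ~> Y ⊗ Z X)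
    (dZ : is_centralizer d) :
  (exists! B : Bimonad Z, is_centralizer_bimonad d B)
  /\ forall B : Bimonad Z, is_centralizer_bimonad d B ->
    is_monadic_with_monad (center_forget C) B
    /\ is_hopf_monad A B
    /\ exists hb : forall M : module_smc B, is_half_braiding (action_braid d M),
         is_strict_monoidal (module_to_center dZ hb)
         /\ is_isomorphism_of_categories (module_to_center dZ hb).
Proof.
split.
- destruct (centralizer_bimonad_exists A dZ) as [B hB].
  exists B; split; [exact hB|]; intros B' hB'.
  exact (centralizer_bimonad_unique A dZ hB hB').
- intros B hB; split; [|split; [split|]].
  + exact (center_forget_monadic A dZ hB).
  + exact (ex_intro _ _ (left_antipodeP A dZ hB)).
  + exact (ex_intro _ _ (right_antipodeP A dZ hB)).
  + exists (action_braid_half A dZ hB); split.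
    * exact (module_to_center_strict A dZ hB).
    * exact (module_to_center_isomorphism A dZ hB).
Qed.
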